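(* Let $c=0$, and let $r,s\in C^1[0,\infty)$ and $u\in C[0,\infty)$ be real-valued functions satisfying $$\dot s(t)=2r(t)u(t),\qquad \dot r(t)=0,$$ so that $r$ is constant, with $\operatorname{sgn}(u(t))=\operatorname{sgn}(r(t))$ for all $t>0$, $r(0)>0$ and $s(0)>0$. Let $h>0$, $k\ge0$. For $t>0$ define $$W_t(x)=\frac1{r\sqrt{2h\pi}}\,e^{-\frac{(x+hs(t))^2}{2hr^2}},\qquad x\in\mathbb R,$$ and let $U_t:\ell^2(\mathbb N)\to L^2(\mathbb R,W_t(x)dx)$ be defined by $$[U_te_n](x)=H_n\Big(\frac{x+hs(t)}{r\sqrt{2h}}\Big).$$ Then $U_t$ is unitary and $U_t\circ\pi_{k,h}(L(t))\circ U_t^*=M(x)$.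
   Context: $\mathbb N=\{0,1,2,\dots\}$. The Lie algebra considered (the oscillator algebra $\mathfrak b(1)$) has basis $E,F,H,N$ with $[E,F]=N$, $[H,E]=2E$, $[H,F]=-2F$, $N$ central, and $*$-structure $H^*=H$, $N^*=N$, $E^*=F$. With $c=0$ the Lax operator is $L(t)=r(t)(E+F)+s(t)N$ (with partner $M(t)=u(t)(E-F)$; the differential equations above are $\dot L=[M,L]$). The representation $\pi_{k,h}$ ($h>0$, $k\ge0$) on $\ell^2(\mathbb N)$ with standard orthonormal basis $\{e_n\}$ is $\pi_{k,h}(N)e_n=-h\,e_n$, $\pi_{k,h}(H)e_n=2(k+n)e_n$, $\pi_{k,h}(E)e_n=\sqrt{h(n+1)}\,e_{n+1}$, $\pi_{k,h}(F)e_n=\sqrt{hn}\,e_{n-1}$. Hence $$\pi_{k,h}(L(t))e_n=r\sqrt{h(n+1)}\,e_{n+1}-hs(t)e_n+r\sqrt{hn}\,e_{n-1}.$$ This operator is densely defined, with domain $\mathcal D$ the finite linear combinations of the $e_n$; the operator identity in the claim is understood on $U_t(\mathcal D)$. Orthonormal Hermite polynomials: $$H_n(x)=\frac{(\sqrt2\,x)^n}{\sqrt{n!}}\;{}_2F_0\Big({-\frac n2,-\frac{n-1}2\atop-};-\frac1{x^2}\Big),$$ which satisfy $\frac1{\sqrt\pi}\int_{\mathbb R}H_nH_{n'}e^{-x^2}dx=\delta_{n,n'}$ and $\sqrt2\,xH_n=\sqrt{n+1}H_{n+1}+\sqrt nH_{n-1}$. $M(f)$ denotes multiplication: $[M(f)g](x)=f(x)g(x)$.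 *)

(* Defs.v *)
From HB Require Import structures.
From mathcomp Require Import all_boot all_order all_algebra generic_quotient.
From mathcomp Require Import ring_quotient ring lra.
From mathcomp Require Import complex.
From mathcomp Require Import all_classical all_reals all_analysis.
From mathcomp Require Import measurable_realfun.

Set Implicit Arguments.
Unset Strict Implicit.
Unset Printing Implicit Defensive.

Import Order.TTheory GRing.Theory Num.Theory.
Import numFieldNormedType.Exports.

Local Open Scope classical_set_scope.
Local Open Scope ring_scope.
Local Open Scope complex_scope.

Section SquareIntegrable.
Context d (T : measurableType d) (R : realType) (mu : {measure set T -> \bar R}).

Definition normc2 (z : R[i]) : R := Normc.normc z ^+ 2.

(* Measurability for the Borel sigma-algebra of the complex plane is
   measurability of the real and imaginary parts. *)
Definition sq_integrable (f : T -> R[i]) : Prop :=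
  [/\ measurable_fun setT (fun x => complex.Re (f x)),
      measurable_fun setT (fun x => complex.Im (f x)) &
      (\int[mu]_x (normc2 (f x))%:E < +oo)%E].

Definition sqint : {pred T -> R[i]} := fun f => `[< sq_integrable f >].

Lemma sqintP (f : T -> R[i]) : reflect (sq_integrable f) (f \in sqint).
Proof. exact: asboolP. Qed.

Lemma normc2E (z : R[i]) :
  normc2 z = complex.Re z ^+ 2 + complex.Im z ^+ 2.
Proof.
by rewrite /normc2; case: z => a b /=; rewrite sqr_sqrtr// addr_ge0// sqr_ge0.
Qed.

Lemma measurable_normc2 (f : T -> R[i]) :
  measurable_fun setT (fun x => complex.Re (f x)) ->
  measurable_fun setT (fun x => complex.Im (f x)) ->
  measurable_fun setT (fun x => (normc2 (f x))%:E).
Proof.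
move=> mr mi; apply/measurable_EFinP.
rewrite (_ : (fun x => _) = (fun x => complex.Re (f x) ^+ 2) \+
                            (fun x => complex.Im (f x) ^+ 2)); last first.
  by apply/funext => x; rewrite normc2E.
by apply: measurable_funD; exact: measurable_funX.
Qed.

Lemma sqint_submod_closed : submod_closed sqint.
Proof.
split.
  apply/sqintP; split; [exact: (@measurable_cst _ _ _ _ _ (0 : R))..|].
  rewrite (eq_integral (cst 0%E)) ?integral0 ?ltry// => x _.
  by rewrite normc2E /= expr0n/= addr0.
move=> a f g /sqintP[mrf mif If] /sqintP[mrg mig Ig]; apply/sqintP.
have mr : measurable_fun setT (fun x => complex.Re ((a *: f + g) x)).
  rewrite (_ : (fun x => _) =
    ((fun x => complex.Re a * complex.Re (f x)) \-
     (fun x => complex.Im a * complex.Im (f x))) \+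
    (fun x => complex.Re (g x))).
    apply: measurable_funD => //; apply: measurable_funB;
      by apply: measurable_funM.
  apply/funext => x; rewrite !fctE /=.
  by case: (f x) (g x) a => [? ?] [? ?] [? ?].
have mi : measurable_fun setT (fun x => complex.Im ((a *: f + g) x)).
  rewrite (_ : (fun x => _) =
    ((fun x => complex.Re a * complex.Im (f x)) \+
     (fun x => complex.Im a * complex.Re (f x))) \+
    (fun x => complex.Im (g x))).
    apply: measurable_funD => //; apply: measurable_funD;
      by apply: measurable_funM.
  apply/funext => x; rewrite !fctE /=.
  by case: (f x) (g x) {mr} a => [? ?] [? ?] [? ?].
split => //.
pose c := 2 * Normc.normc a ^+ 2.
have c0 : 0 <= c by rewrite mulr_ge0// sqr_ge0.
apply: (@le_lt_trans _ _ (\int[mu]_x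
   (c%:E * (normc2 (f x))%:E + 2%:E * (normc2 (g x))%:E))%E).
  apply: ge0_le_integral => //.
  - by move=> x _; rewrite lee_fin sqr_ge0.
  - exact: measurable_normc2.
  - by apply: emeasurable_funD; apply: emeasurable_funM => //;
       exact: measurable_normc2.
  move=> x _; rewrite -!EFinM -EFinD lee_fin /normc2 {mr mi c0}/c.
  rewrite -!/(normc2 _) !normc2E !fctE /=.
  case: (f x) (g x) a => [f1 f2] [g1 g2] [a1 a2] /=.
  set p := a1 * f1 - a2 * f2; set q := a1 * f2 + a2 * f1.
  have -> : 2 * (a1 ^+ 2 + a2 ^+ 2) * (f1 ^+ 2 + f2 ^+ 2)
    = 2 * (p ^+ 2 + q ^+ 2) by rewrite /p /q; ring.
  have := sqr_ge0 (p - g1); have := sqr_ge0 (q - g2); nra.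
rewrite ge0_integralD//; first last.
- by apply: emeasurable_funM => //; exact: measurable_normc2.
- by move=> x _; rewrite mule_ge0// lee_fin sqr_ge0.
- by apply: emeasurable_funM => //; exact: measurable_normc2.
- by move=> x _; rewrite mule_ge0// lee_fin ?sqr_ge0.
rewrite !ge0_integralZl//; do ?[exact: measurable_normc2
  | by move=> x _; rewrite lee_fin sqr_ge0 | by []].
by rewrite lte_add_pinfty// lte_mul_pinfty.
Qed.

HB.instance Definition _ :=
  GRing.isSubmodClosed.Build R[i] (T -> R[i]) sqint sqint_submod_closed.

Record L2fun := MkL2fun { L2fun_val :> T -> R[i]; _ : L2fun_val \in sqint }.
HB.instance Definition _ := [isSub for L2fun_val].
HB.instance Definition _ := [Choice of L2fun by <:].
HB.instance Definition _ := [SubChoice_isSubLmodule of L2fun by <:].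

Definition ae_null : {pred L2fun} := fun f : L2fun => `[< {ae mu, forall x, f x = 0} >].

Lemma ae_nullP (f : L2fun) : reflect {ae mu, forall x, f x = 0} (f \in ae_null).
Proof. exact: asboolP. Qed.

Lemma ae_null_submod_closed : submod_closed ae_null.
Proof.
split; first by apply/ae_nullP/nearW.
move=> a f g /ae_nullP f0 /ae_nullP g0; apply/ae_nullP.
apply: filterS2 f0 g0 => x fx gx.
by rewrite -[LHS]/(a * f x + g x) fx gx mulr0 addr0.
Qed.

HB.instance Definition _ :=
  GRing.isSubmodClosed.Build R[i] L2fun ae_null ae_null_submod_closed.

Definition L2 : Type := Quotient.quot ae_null.
HB.instance Definition _ := EqQuotient.on L2.
HB.instance Definition _ := GRing.Zmodule.on L2.

Local Open Scope quotient_scope.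

Lemma L2_piD (f g : L2fun) : \pi_L2 (f + g) = \pi_L2 f + \pi_L2 g.
Proof. exact: (@Quotient.pi_add _ ae_null). Qed.

Definition L2_to_fun (f : L2) : T -> R[i] := L2fun_val (repr f).

Definition L2_scale (a : R[i]) (f : L2) : L2 := \pi_L2 (a *: repr f).

Lemma L2_scaleE a (f : L2fun) : L2_scale a (\pi_L2 f) = \pi_L2 (a *: f).
Proof.
apply/eqP; rewrite -Quotient.idealrBE -scalerBr rpredZ//.
by rewrite Quotient.idealrBE reprK.
Qed.

Let scaleA a b f : L2_scale a (L2_scale b f) = L2_scale (a * b) f.
Proof. by rewrite -[f]reprK (L2_scaleE b) !L2_scaleE scalerA. Qed.

Let scale1 : left_id 1 L2_scale.
Proof. by move=> f; rewrite -[f]reprK L2_scaleE scale1r. Qed.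

Let scaleDr : right_distributive L2_scale +%R.
Proof.
move=> a f g; rewrite -[f]reprK -[g]reprK !L2_scaleE.
by rewrite -!L2_piD L2_scaleE scalerDr.
Qed.

Let scaleDl f : {morph L2_scale^~ f : a b / a + b}.
Proof.
move=> a b; rewrite -[f]reprK !L2_scaleE.
by rewrite -L2_piD scalerDl.
Qed.

HB.instance Definition _ :=
  GRing.Zmodule_isLmodule.Build R[i] L2 scaleA scale1 scaleDr scaleDl.

Definition L2_ip (f g : L2) : R[i] :=
  let fg x := L2_to_fun f x * (L2_to_fun g x)^* in
  (\int[mu]_x complex.Re (fg x)) +i* (\int[mu]_x complex.Im (fg x)).

Definition L2_norm (f : L2) : R := Num.sqrt (complex.Re (L2_ip f f)).

(* f is the class of g; in particular g is square integrable up to a null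
   set. *)
Definition represents (f : L2) (g : T -> R[i]) : Prop :=
  {ae mu, forall x, L2_to_fun f x = g x}.

End SquareIntegrable.
Coercion L2_to_fun : L2 >-> Funclass.

Section Operators.
Context d1 d2 (S : measurableType d1) (T : measurableType d2) (R : realType).
Context (mu : {measure set S -> \bar R}) (nu : {measure set T -> \bar R}).

Definition bounded_op (U : L2 mu -> L2 nu) : Prop :=
  exists c : R, forall f, L2_norm (U f) <= c * L2_norm f.

Definition is_adjoint (U : L2 mu -> L2 nu) (V : L2 nu -> L2 mu) : Prop :=
  forall f g, L2_ip (U f) g = L2_ip f (V g).

(* The adjoint, unique when it exists; the null map when there is none. *)
Definition adjoint (U : L2 mu -> L2 nu) : L2 nu -> L2 mu :=
  xget (fun=> 0) [set V | is_adjoint U V].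

Definition unitary (U : L2 mu -> L2 nu) : Prop :=
  [/\ is_adjoint U (adjoint U), cancel U (adjoint U) & cancel (adjoint U) U].

End Operators.

Section Weighted.
Context d (T : measurableType d) (R : realType) (mu : {measure set T -> \bar R}).
Variable w : T -> R.

(* The measure w dmu; the null measure if w is not a legitimate density. *)
Definition weighted (A : set T) : \bar R :=
  if `[< measurable_fun setT w /\ forall x, 0 <= w x >]
  then (\int[mu]_(x in A) (w x)%:E)%E else 0%E.

Let weighted0 : weighted set0 = 0%E.
Proof. by rewrite /weighted integral_set0 if_same. Qed.

Let weighted_ge0 A : (0 <= weighted A)%E.
Proof.
rewrite /weighted; case: asboolP => // -[_ w0].
by apply: integral_ge0 => x _; rewrite lee_fin.
Qed.

Let weighted_sigma_additive : semi_sigma_additive weighted.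
Proof.
rewrite /weighted; case: asboolP => [[mw w0]|_].
  apply: semi_sigma_additive_nng_induced; first exact/measurable_EFinP.
  by move=> x; rewrite lee_fin.
move=> F _ _ _; under eq_fun do rewrite big1//; exact: cvg_cst.
Qed.

HB.instance Definition _ := isMeasure.Build _ _ _ weighted
  weighted0 weighted_ge0 weighted_sigma_additive.

End Weighted.

Notation ell2 R := (L2 (@counting nat R)).

Section Ell2.
Variable R : realType.

Lemma ell2_basis_subproof (n : nat) :
  (fun m : nat => (m == n)%:R : R[i]) \in sqint (@counting nat R).
Proof.
apply/sqintP; split => //.
rewrite ge0_integral_count; last by move=> m; rewrite lee_fin sqr_ge0.
rewrite (@nneseries_split _ _ _ n.+1)//; last first.
  by move=> m _; rewrite lee_fin sqr_ge0.
rewrite add0n [X in (_ + X)%E]eseries0 ?adde0; last first.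
  move=> m; rewrite /= => nm _.
  by rewrite gtn_eqF//= normc2E/= expr0n/= addr0.
by rewrite sumEFin ltry.
Qed.

Definition ell2_basis (n : nat) : ell2 R :=
  \pi_(ell2 R)%qT (MkL2fun (ell2_basis_subproof n)).

Lemma ell2_basisE (n m : nat) : ell2_basis n m = (m == n)%:R.
Proof.
have : {ae @counting nat R, forall m, ell2_basis n m = (m == n)%:R}.
  have /eqP : (repr (ell2_basis n) == MkL2fun (ell2_basis_subproof n) %[mod ell2 R])%qT.
    by rewrite reprK.
  move=> /eqP; rewrite -Quotient.idealrBE => /ae_nullP; apply: filterS => x.
  by move=> /eqP; rewrite subr_eq0 => /eqP.
move=> [N [_ N0 /(_ m)]] sub.
apply: contrapT => /sub Nm; move: N0; rewrite /counting.
case: asboolP => // Nfin [] /eqP; rewrite pnatr_eq0 finmap.cardfs_eq0 => /eqP.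
by move=> /(fset_set_set0 Nfin) N0; rewrite N0 in Nm.
Qed.

Definition finite_combinations : set (ell2 R) :=
  [set v | exists (N : nat) (c : nat -> R[i]),
             v = \sum_(n < N) c n *: ell2_basis n].

End Ell2.
Arguments finite_combinations R : clear implicits.

Section Oscillator.
Variable R : realType.

(* Elements of the oscillator algebra, by their coordinates in the basis
   (E, F, H, N). Only the linear structure is needed here, not the bracket. *)
Local Notation osc := 'rV[R[i]]_4.

Definition oscE : osc := delta_mx 0 0.
Definition oscF : osc := delta_mx 0 1.
Definition oscH : osc := delta_mx 0 2.
Definition oscN : osc := delta_mx 0 3.

Variables (h k : R).
Local Notation e := (@ell2_basis R).

(* For n = 0 the F-term is e_(-1) with coefficient 0. *)
Definition osc_rep_basis (X : osc) (n : nat) : ell2 R :=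
    X 0 0 *: ((Num.sqrt (h * n.+1%:R))%:C *: e n.+1)
  + X 0 1 *: ((Num.sqrt (h * n%:R))%:C *: e n.-1)
  + X 0 2 *: ((2 * (k + n%:R))%:C *: e n)
  + X 0 3 *: ((- h)%:C *: e n).

(* Linear extension to the domain of finite combinations of the e_n; the sum
   has finite support there, and values outside the domain are junk. *)
Definition osc_rep (X : osc) (v : ell2 R) : ell2 R :=
  \sum_(n \in [set: nat]) v n *: osc_rep_basis X n.

Definition lax_L (r s : R) : osc := r%:C *: (oscE + oscF) + s%:C *: oscN.

Lemma osc_rep_basis_lax (r s : R) (n : nat) :
  osc_rep_basis (lax_L r s) n =
    (r * Num.sqrt (h * n.+1%:R))%:C *: e n.+1
  - (h * s)%:C *: e n
  + (r * Num.sqrt (h * n%:R))%:C *: e n.-1.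
Proof.
rewrite /osc_rep_basis /lax_L !mxE /= !scalerA.
rewrite !(mulr0, mulr1, add0r, addr0, mul0r, scale0r) -!rmorphM/= addrAC.
by rewrite mulrN [s * h]mulrC rmorphN scaleNr.
Qed.

End Oscillator.

Section Hermite.
Variable R : realType.

Definition pochhammer (a : R) (j : nat) : R := \prod_(i < j) (a + i%:R).

Definition hyp2F0_coef (a b : R) (j : nat) : R :=
  pochhammer a j * pochhammer b j / j`!%:R.

Definition hyp2F0 (a b z : R) : R :=
  limn (series (fun j => hyp2F0_coef a b j * z ^+ j)).

(* (sqrt 2 x)^n / sqrt n! * 2F0(-n/2, -(n-1)/2; -; -1/x^2), multiplied out so
   that it is a polynomial, meaningful at x = 0 too: see hermite_hyp2F0. *)
Definition hermite (n : nat) : {poly R} :=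
  (Num.sqrt 2 ^+ n / Num.sqrt n`!%:R) *:
  \sum_(j < n./2.+1)
    (hyp2F0_coef (- (n%:R / 2)) (- ((n%:R - 1) / 2)) j * (-1) ^+ j)
      *: 'X^(n - j.*2).

Lemma pochhammer_eq0 (a : R) (i j : nat) :
  a = - i%:R -> (i < j)%N -> pochhammer a j = 0.
Proof.
by move=> -> ij; rewrite /pochhammer (bigD1 (Ordinal ij))//= addNr mul0r.
Qed.

Lemma hermite_coef_eq0 (n j : nat) : (n./2 < j)%N ->
  hyp2F0_coef (- (n%:R / 2)) (- ((n%:R - 1) / 2)) j = 0.
Proof.
move=> nj; rewrite /hyp2F0_coef.
have : n%:R = (odd n)%:R + 2 * n./2%:R :> R.
  by rewrite -[LHS](congr1 _ (odd_double_half n)) natrD -mul2n natrM.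
case: (odd n) => /= nE.
- rewrite [X in _ * X / _](@pochhammer_eq0 _ n./2)// ?mulr0 ?mul0r//.
  by rewrite nE; field.
- rewrite (@pochhammer_eq0 _ n./2)// ?mul0r//.
  by rewrite nE; field.
Qed.

Lemma hermite_hyp2F0 (n : nat) (x : R) : x != 0 ->
  (hermite n).[x] = (Num.sqrt 2 * x) ^+ n / Num.sqrt n`!%:R *
    hyp2F0 (- (n%:R / 2)) (- ((n%:R - 1) / 2)) (- (x ^+ 2)^-1).
Proof.
move=> x0; rewrite /hyp2F0.
set c := hyp2F0_coef _ _.
have -> : limn (series (fun j => c j * (- (x ^+ 2)^-1) ^+ j)) =
    \sum_(j < n./2.+1) c j * (- (x ^+ 2)^-1) ^+ j.
  apply/cvg_lim => //; apply: cvg_near_cst; exists n./2.+1 => // N /= nN.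
  have c0 j : (n./2.+1 <= j < N)%N -> c j * (- (x ^+ 2)^-1) ^+ j = 0.
    by move=> /andP[nj _]; rewrite /c hermite_coef_eq0// mul0r.
  rewrite /series /= (big_cat_nat (leq0n _) nN)/= big_mkord.
  by rewrite [X in _ + X]big_nat [X in _ + X]big1 ?addr0.
rewrite hornerZ horner_sum !mulr_sumr; apply: eq_bigr => j _.
rewrite hornerZ hornerXn -/c exprMn [(- _^-1) ^+ _]exprNn exprVn -exprM mul2n.
have jn : (j.*2 <= n)%N by rewrite -geq_half_double -ltnS.
rewrite -[in x ^+ n](subnK jn) exprD.
have xj : x ^+ j.*2 != 0 by rewrite expf_neq0.
move: (Num.sqrt n`!%:R)^-1 => y.
by field.
Qed.

End Hermite.

Section Weight.
Variable R : realType.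

Definition gauss_weight (h r s x : R) : R :=
  (r * Num.sqrt (2 * h * pi))^-1 *
  expR (- ((x + h * s) ^+ 2 / (2 * h * r ^+ 2))).

Lemma gauss_weight_ge0 h r s x : 0 <= r -> 0 <= gauss_weight h r s x.
Proof.
by move=> r0; rewrite mulr_ge0 ?expR_ge0// invr_ge0 mulr_ge0 ?sqrtr_ge0.
Qed.

Lemma measurable_gauss_weight h r s :
  measurable_fun setT (gauss_weight h r s).
Proof.
apply: measurable_funM => //; apply: measurableT_comp => //.
apply: measurableT_comp => //; apply: measurable_funM => //.
by apply: measurable_funX; apply: measurable_funD.
Qed.

End Weight.

Notation gauss_measure h r s :=
  (weighted (@lebesgue_measure _) (gauss_weight h r s)).

(* U e_n = H_n((x + h s) / (r sqrt(2 h))) for all n, U being extended from the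
   e_n to ell2 by linearity and continuity. *)
Definition hermite_operator (R : realType) (h r s : R)
    (U : {linear ell2 R -> L2 (gauss_measure h r s)}) : Prop :=
  bounded_op U /\
  forall n, represents (U (ell2_basis R n))
    (fun x => ((hermite R n).[(x + h * s) / (r * Num.sqrt (2 * h))])%:C).

Section HalfLine.
Variable R : realType.

(* One-sided at 0: the difference quotient is taken inside A. *)
Definition has_deriv_within (A : set R) (f : R -> R) (t f't : R) : Prop :=
  (f y - f t) / (y - t) @[y --> within A (t^')] --> f't.

Definition C1_on (A : set R) (f : R -> R) : Prop :=
  exists2 f' : R -> R, {within A, continuous f'} &
    forall t, A t -> has_deriv_within A f t (f' t).

End HalfLine.

(* Main.v *)
(** The Hermite functions are orthonormal and total in L2 of the Gaussian
    measure, so the map sending the standard basis of l2 to them extends to a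
    unitary; the three-term recurrence of the Hermite polynomials says that it
    intertwines the Jacobi operator with multiplication by x.

    Orthonormality comes from Gaussian integration by parts applied to
    [sqrt (n+1) H_(n+1) = sqrt 2 x H_n - H_n' / sqrt 2].

    Totality avoids Fourier analysis: if F is orthogonal to all polynomials,
    expanding the exponential shows that F is orthogonal to every power of
    [y = exp (- l (x - a) (x - b))] for small l > 0, hence to
    [1 - (1 - (y / 2)^n)^(2^n)], which converges boundedly to the indicator
    function of the interval ]a, b[. *)
Require Import Defs.
From HB Require Import structures.
From mathcomp Require Import all_boot all_order all_algebra generic_quotient.
From mathcomp Require Import ring_quotient zify ring lra.
From mathcomp Require Import complex.
From mathcomp Require Import all_classical all_reals all_analysis.
From mathcomp Require Import measurable_realfun.

Set Implicit Arguments.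
Unset Strict Implicit.
Unset Printing Implicit Defensive.

Import Order.TTheory GRing.Theory Num.Theory.
Import numFieldNormedType.Exports.

Local Open Scope classical_set_scope.
Local Open Scope ring_scope.
Local Open Scope complex_scope.

(** Elements of L2 are classes, so computations pass through [represents], which trades a class for
    a concrete function up to a null set. The operator is built from coefficients: [U f] is the
    element whose Hermite coefficients are the coordinates of [f]. It exists because L2 is complete
    and is unique because the family is total, so linearity and the inverse reduce to comparing
    coefficients.

    In the totality argument [(x - a) (x - b)] is negative exactly on []a, b[], so [y / 2] exceeds
    1/2 exactly there, and 1/2 is the threshold at which [2 ^ n * (y / 2) ^ n] changes from
    vanishing to exploding. Expanding a whole power of [y] at once would force [l] to shrink with
    the power, since a Gaussian integrates [exp (c x ^ 2)] only for small [c]. The factors are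
    therefore expanded one at a time, the remaining ones being bounded; a single [l] then serves all
    powers, which the limit over [n] demands.

    The equation for [r] gives [r t = r 0 > 0], so the Gaussian is nondegenerate. *)

Local Notation Re := complex.Re.
Local Notation Im := complex.Im.

(** * The inner product of L2 *)

Section ComplexParts.
Variable R : realType.
Implicit Types z w : R[i].

Lemma Re_add z w : Re (z + w) = Re z + Re w. Proof. by case: z w => ? ? []. Qed.

Lemma Re_opp z : Re (- z) = - Re z. Proof. by case: z. Qed.

Lemma Im_add z w : Im (z + w) = Im z + Im w. Proof. by case: z w => ? ? []. Qed.

Lemma Im_opp z : Im (- z) = - Im z. Proof. by case: z. Qed.

Lemma normc2B z w :
  normc2 (z - w) = (Re z - Re w) ^+ 2 + (Im z - Im w) ^+ 2.
Proof. by rewrite normc2E Re_add Re_opp Im_add Im_opp. Qed.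

Lemma normc2C (x : R) : normc2 x%:C = x ^+ 2.
Proof. by rewrite normc2E /= expr0n addr0. Qed.

Lemma normc2_eq0 z : normc2 z = 0 -> z = 0.
Proof.
rewrite normc2E => /eqP; rewrite paddr_eq0 ?sqr_ge0// !sqrf_eq0.
by case: z => p q /= /andP[/eqP -> /eqP ->].
Qed.

Lemma mulC_conj z : z * z^* = (normc2 z)%:C.
Proof. by rewrite normc2E; case: z => p q; congr (_ +i* _) => /=; ring. Qed.

End ComplexParts.

Section L2Theory.
Context d (T : measurableType d) (R : realType) (mu : {measure set T -> \bar R}).
Implicit Types (f g : L2 mu) (F G : T -> R[i]) (a b : R[i]).

Lemma ae_eq_Rintegral (u v : T -> R) :
  measurable_fun setT u -> measurable_fun setT v ->
  {ae mu, forall x, u x = v x} ->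
  (\int[mu]_x u x) = (\int[mu]_x v x) :> R.
Proof.
move=> mu_ mv uv; congr fine; apply: ae_eq_integral => //.
- exact/measurable_EFinP.
- exact/measurable_EFinP.
- by apply: filterS uv => x ->.
Qed.

Lemma L2_sq_integrable f : sq_integrable mu f.
Proof. by rewrite /L2_to_fun; case: (repr f) => F /= /sqintP. Qed.

Lemma L2_measurable_Re f : measurable_fun setT (fun x => Re (f x)).
Proof. by case: (L2_sq_integrable f). Qed.

Lemma L2_measurable_Im f : measurable_fun setT (fun x => Im (f x)).
Proof. by case: (L2_sq_integrable f). Qed.

Lemma represents_pi (F : L2fun mu) : represents (\pi_(L2 mu)%qT F) F.
Proof.
have : (repr (\pi_(L2 mu) F)%qT == F %[mod L2 mu])%qT by rewrite reprK.
rewrite -Quotient.idealrBE => /ae_nullP; apply: filterS => x.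
by move=> /eqP; rewrite subr_eq0 => /eqP.
Qed.

Lemma represents_self f : represents f f.
Proof. exact: nearW. Qed.

Lemma represents_inj f g F : represents f F -> represents g F -> f = g.
Proof.
move=> fF gF; rewrite -[f]reprK -[g]reprK.
apply/eqP; rewrite -Quotient.idealrBE; apply/ae_nullP.
apply: filterS2 fF gF => x fx gx.
by rewrite -[LHS]/(L2_to_fun f x - L2_to_fun g x) fx gx subrr.
Qed.

Lemma represents_ae f F G :
  represents f F -> {ae mu, forall x, F x = G x} -> represents f G.
Proof. by apply: filterS2 => x ->. Qed.

Lemma represents_ex F : sq_integrable mu F -> exists f, represents f F.
Proof.
move=> /sqintP sF; exists (\pi_(L2 mu)%qT (MkL2fun sF)).
exact: represents_pi.
Qed.

Lemma represents0 : represents (0 : L2 mu) (fun=> 0).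
Proof.
have -> : (0 : L2 mu) = (\pi_(L2 mu)%qT 0).
  by apply: (addrI (\pi_(L2 mu)%qT 0)); rewrite -L2_piD !addr0.
exact: represents_pi.
Qed.

Lemma representsD f g F G : represents f F -> represents g G ->
  represents (f + g) (fun x => F x + G x).
Proof.
move=> fF gG; have := represents_pi (repr f + repr g).
rewrite L2_piD !reprK; apply: filterS3 fF gG => x fx gx ->.
by rewrite -fx -gx.
Qed.

Lemma representsZ a f F : represents f F ->
  represents (a *: f) (fun x => a * F x).
Proof.
move=> fF; have := represents_pi (a *: repr f).
rewrite -L2_scaleE reprK; apply: filterS2 fF => x fx ->.
by rewrite -fx.
Qed.

Lemma representsB f g F G : represents f F -> represents g G ->
  represents (f - g) (fun x => F x - G x).
Proof.
move=> fF gG; rewrite -scaleN1r.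
apply: represents_ae (representsD fF (representsZ (-1) gG)) _.
by apply: nearW => x; rewrite mulN1r.
Qed.

Lemma represents_sum n (f_ : nat -> L2 mu) (F_ : nat -> T -> R[i]) :
  (forall i, represents (f_ i) (F_ i)) ->
  represents (\sum_(i < n) f_ i) (fun x => \sum_(i < n) F_ i x).
Proof.
move=> fF; elim: n => [|n IH].
  rewrite big_ord0; apply: represents_ae represents0 _.
  by apply: nearW => x; rewrite big_ord0.
rewrite big_ord_recr; apply: represents_ae (representsD IH (fF n)) _.
by apply: nearW => x /=; rewrite big_ord_recr.
Qed.

(** Meant for [u] a real or imaginary part of a product of [F] with a conjugate of [G], where the
    bound is a form of [2 |z w| <= |z|^2 + |w|^2]. The integrability obtained is what makes the
    inner product additive. *)
Lemma sq_integrable_mul F G (u : T -> R) :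
  sq_integrable mu F -> sq_integrable mu G -> measurable_fun setT u ->
  (forall x, `|u x| <= normc2 (F x) + normc2 (G x)) ->
  mu.-integrable setT (EFin \o u).
Proof.
move=> [mF1 mF2 iF] [mG1 mG2 iG] mu_ uFG.
have mF := measurable_normc2 mF1 mF2; have mG := measurable_normc2 mG1 mG2.
have n0 (z : R[i]) : 0 <= normc2 z by rewrite sqr_ge0.
apply: (@le_integrable _ _ _ _ _ _ _
   (fun x => (normc2 (F x))%:E + (normc2 (G x))%:E)%E) => //.
- exact/measurable_EFinP.
- by move=> x _ /=; rewrite lee_fin [leRHS]ger0_norm ?addr_ge0.
apply: integrableD => //; apply/integrableP; split => //.
  by under eq_integral do rewrite gee0_abs ?lee_fin//.
by under eq_integral do rewrite gee0_abs ?lee_fin//.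
Qed.

Lemma Re_mulC_conj (z w : R[i]) : Re (z * w^*) = Re z * Re w + Im z * Im w.
Proof. by case: z w => [? ?] [? ?] /=; rewrite mulrN opprK. Qed.

Lemma Im_mulC_conj (z w : R[i]) : Im (z * w^*) = Im z * Re w - Re z * Im w.
Proof. by case: z w => [? ?] [? ?] /=; rewrite mulrN addrC. Qed.

Lemma measurable_Re_mul F G : sq_integrable mu F -> sq_integrable mu G ->
  measurable_fun setT (fun x => Re (F x * (G x)^*)).
Proof.
move=> [F1 F2 _] [G1 G2 _]; under eq_fun do rewrite Re_mulC_conj.
by apply: measurable_funD; apply: measurable_funM.
Qed.

Lemma measurable_Im_mul F G : sq_integrable mu F -> sq_integrable mu G ->
  measurable_fun setT (fun x => Im (F x * (G x)^*)).
Proof.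
move=> [F1 F2 _] [G1 G2 _]; under eq_fun do rewrite Im_mulC_conj.
by apply: measurable_funB; apply: measurable_funM.
Qed.

Lemma integrable_Re_mul F G : sq_integrable mu F -> sq_integrable mu G ->
  mu.-integrable setT (EFin \o (fun x => Re (F x * (G x)^*))).
Proof.
move=> iF iG; apply: (sq_integrable_mul iF iG); first exact: measurable_Re_mul.
move=> x; rewrite Re_mulC_conj !normc2E.
case: (F x) (G x) => [p q] [r s] /=; rewrite ler_norml.
have := sqr_ge0 (p - r); have := sqr_ge0 (q - s).
have := sqr_ge0 (p + r); have := sqr_ge0 (q + s).
have := sqr_ge0 p; have := sqr_ge0 q.
have := sqr_ge0 r; have := sqr_ge0 s.
by move=> *; apply/andP; split; nra.
Qed.

Lemma integrable_Im_mul F G : sq_integrable mu F -> sq_integrable mu G ->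
  mu.-integrable setT (EFin \o (fun x => Im (F x * (G x)^*))).
Proof.
move=> iF iG; apply: (sq_integrable_mul iF iG); first exact: measurable_Im_mul.
move=> x; rewrite Im_mulC_conj !normc2E.
case: (F x) (G x) => [p q] [r s] /=; rewrite ler_norml.
have := sqr_ge0 (p - s); have := sqr_ge0 (q - r).
have := sqr_ge0 (p + s); have := sqr_ge0 (q + r).
have := sqr_ge0 p; have := sqr_ge0 q.
have := sqr_ge0 r; have := sqr_ge0 s.
by move=> *; apply/andP; split; nra.
Qed.

(** [L2_ip] integrates the representatives picked by [repr]; this allows any other square integrable
    representatives in their place. *)
Lemma L2_ipE f g F G : sq_integrable mu F -> sq_integrable mu G ->
  represents f F -> represents g G ->
  L2_ip f g = (\int[mu]_x Re (F x * (G x)^*)) +i*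
              (\int[mu]_x Im (F x * (G x)^*)).
Proof.
have sf := L2_sq_integrable f; have sg := L2_sq_integrable g.
move=> sF sG fF gG; rewrite /L2_ip; congr (_ +i* _); apply: ae_eq_Rintegral.
- exact: measurable_Re_mul.
- exact: measurable_Re_mul.
- by apply: filterS2 fF gG => x -> ->.
- exact: measurable_Im_mul.
- exact: measurable_Im_mul.
- by apply: filterS2 fF gG => x -> ->.
Qed.

Lemma sq_integrable_lin a F G : sq_integrable mu F -> sq_integrable mu G ->
  sq_integrable mu (fun x => a * F x + G x).
Proof.
move=> /sqintP sF /sqintP sG; apply/sqintP.
exact: (sqint_submod_closed mu).2.
Qed.

Lemma L2_ip_lin a f f' g : L2_ip (a *: f + f') g = a * L2_ip f g + L2_ip f' g.
Proof.
have sf := L2_sq_integrable f; have sf' := L2_sq_integrable f'.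
have sg := L2_sq_integrable g.
rewrite (L2_ipE _ _ (representsD (representsZ a (represents_self f))
   (represents_self f')) (represents_self g))//; last exact: sq_integrable_lin.
rewrite /L2_ip; case: a => p q /=.
have iR := integrable_Re_mul sf sg; have iI := integrable_Im_mul sf sg.
have iR' := integrable_Re_mul sf' sg; have iI' := integrable_Im_mul sf' sg.
have iZ r (h : T -> R) : mu.-integrable setT (EFin \o h) ->
    mu.-integrable setT (EFin \o (fun x => r * h x)).
  by move=> ih; exact: (integrableZl measurableT r ih).
have iD (h h' : T -> R) : mu.-integrable setT (EFin \o h) ->
    mu.-integrable setT (EFin \o h') ->
    mu.-integrable setT (EFin \o (fun x => h x + h' x)).
  by move=> ih ih'; exact: (integrableD measurableT ih ih').
congr (_ +i* _).
- rewrite (@eq_Rintegral _ _ _ mu setT (fun x => (p * Re (f x * (g x)^*) +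
    - q * Im (f x * (g x)^*)) + Re (f' x * (g x)^*))); last first.
    by move=> x _; rewrite mulrDl;
      case: (f x) (f' x) (g x) => [? ?] [? ?] [? ?] /=; ring.
  rewrite RintegralD//; last by apply: iD; exact: iZ.
  by rewrite RintegralD ?RintegralZl// ?mulNr//; exact: iZ.
- rewrite (@eq_Rintegral _ _ _ mu setT (fun x => (p * Im (f x * (g x)^*) +
    q * Re (f x * (g x)^*)) + Im (f' x * (g x)^*))); last first.
    by move=> x _; rewrite mulrDl;
      case: (f x) (f' x) (g x) => [? ?] [? ?] [? ?] /=; ring.
  rewrite RintegralD//; last by apply: iD; exact: iZ.
  by rewrite RintegralD ?RintegralZl//; exact: iZ.
Qed.

Lemma L2_ipC f g : L2_ip g f = (L2_ip f g)^*.
Proof.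
rewrite /L2_ip; congr (_ +i* _).
  by apply: eq_Rintegral => x _; rewrite !Re_mulC_conj; ring.
rewrite -[RHS]mulN1r -RintegralZl//; last first.
  by apply: integrable_Im_mul; exact: L2_sq_integrable.
by apply: eq_Rintegral => x _; rewrite !Im_mulC_conj; ring.
Qed.

Lemma L2_ipDl f f' g : L2_ip (f + f') g = L2_ip f g + L2_ip f' g.
Proof. by rewrite -[f]scale1r L2_ip_lin mul1r scale1r. Qed.

Lemma L2_ip0l g : L2_ip 0 g = 0.
Proof. by apply: (addrI (L2_ip 0 g)); rewrite -L2_ipDl !addr0. Qed.

Lemma L2_ipZl a f g : L2_ip (a *: f) g = a * L2_ip f g.
Proof. by rewrite -[a *: f]addr0 L2_ip_lin L2_ip0l addr0. Qed.

Lemma L2_ipBl f f' g : L2_ip (f - f') g = L2_ip f g - L2_ip f' g.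
Proof. by rewrite -scaleN1r L2_ipDl L2_ipZl mulN1r. Qed.

Lemma L2_ip_suml n (f_ : nat -> L2 mu) g :
  L2_ip (\sum_(i < n) f_ i) g = \sum_(i < n) L2_ip (f_ i) g.
Proof.
elim: n => [|n IH]; first by rewrite !big_ord0 L2_ip0l.
by rewrite !big_ord_recr L2_ipDl IH.
Qed.

Lemma L2_ipDr f g g' : L2_ip f (g + g') = L2_ip f g + L2_ip f g'.
Proof. by rewrite 3!(L2_ipC _ f) L2_ipDl; exact: (rmorphD conjc). Qed.

Lemma L2_ipBr f g g' : L2_ip f (g - g') = L2_ip f g - L2_ip f g'.
Proof. by rewrite 3!(L2_ipC _ f) L2_ipBl; exact: (rmorphB conjc). Qed.

Lemma L2_ipZr a f g : L2_ip f (a *: g) = a^* * L2_ip f g.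
Proof. by rewrite 2!(L2_ipC _ f) L2_ipZl; exact: (rmorphM conjc). Qed.

End L2Theory.

(** * The squared norm *)

Section L2Norm.
Context d (T : measurableType d) (R : realType) (mu : {measure set T -> \bar R}).
Implicit Types (f g : L2 mu) (a b : R[i]).

(** The square of [L2_norm], which keeps square roots out of the estimates and limits. *)
Definition nsq f : R := Re (L2_ip f f).

Lemma nsqE f : (nsq f)%:E = (\int[mu]_x (normc2 (f x))%:E)%E.
Proof.
have [mr mi fi] := L2_sq_integrable f.
rewrite /nsq /= /Rintegral fineK; last first.
  apply: integrable_fin_num => //; apply: integrable_Re_mul;
    exact: L2_sq_integrable.
by apply: eq_integral => x _; rewrite Re_mulC_conj normc2E -!expr2.
Qed.

Lemma nsq_ge0 f : 0 <= nsq f.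
Proof.
by rewrite -lee_fin nsqE; apply: integral_ge0 => x _; rewrite lee_fin sqr_ge0.
Qed.

Lemma L2_ipff f : L2_ip f f = (nsq f)%:C.
Proof.
rewrite /nsq; have := L2_ipC f f; case: (L2_ip f f) => p q [] qN.
by congr (_ +i* _); lra.
Qed.

Lemma L2_normE f : L2_norm f = Num.sqrt (nsq f). Proof. by []. Qed.

Lemma nsq_eq0 f : nsq f = 0 -> f = 0.
Proof.
move=> f0; have [mr mi fi] := L2_sq_integrable f.
apply: (represents_inj (represents_self f)).
apply: represents_ae (represents0 mu) _.
have : (\int[mu]_x `|(normc2 (f x))%:E| = 0)%E.
  rewrite -[RHS](congr1 EFin f0) nsqE; apply: eq_integral => x _.
  by rewrite gee0_abs// lee_fin sqr_ge0.
move=> /ae_eq_integral_abs => /(_ measurableT (measurable_normc2 mr mi)).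
by apply: filterS => x /(_ I) [] /normc2_eq0.
Qed.

Lemma nsqD f g : nsq (f + g) = nsq f + nsq g + 2 * Re (L2_ip f g).
Proof.
rewrite /nsq L2_ipDl !L2_ipDr !Re_add (L2_ipC f g).
by move: (L2_ip f g) => [p q] /=; ring.
Qed.

Lemma nsqZ a f : nsq (a *: f) = normc2 a * nsq f.
Proof.
rewrite /nsq L2_ipZl L2_ipZr L2_ipff normc2E.
by case: a => p q /=; ring.
Qed.

Lemma nsqB f g : nsq (f - g) = nsq f + nsq g - 2 * Re (L2_ip f g).
Proof.
rewrite /nsq L2_ipBl !L2_ipBr !(Re_add, Re_opp) (L2_ipC f g).
by move: (L2_ip f g) => [p q] /=; ring.
Qed.

Lemma nsqN f : nsq (- f) = nsq f.
Proof. by rewrite -[- f]sub0r nsqB L2_ip0l /nsq L2_ip0l /= mulr0 subr0 add0r. Qed.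

Lemma nsqBC f g : nsq (f - g) = nsq (g - f).
Proof. by rewrite -nsqN opprB. Qed.

Lemma nsqD_le f g : nsq (f + g) <= 2 * nsq f + 2 * nsq g.
Proof. by have := nsq_ge0 (f - g); rewrite nsqB nsqD; lra. Qed.

End L2Norm.

(** * Completeness of L2 *)

(** The telescoping series converges absolutely, by comparison with a geometric series of ratio
    1/2. *)
Lemma geometric_increments_cvg (R : realType) (w : nat -> R) (M : R) :
  (forall k, `|w k.+1 - w k| <= M / 2 ^+ k) -> cvgn w.
Proof.
move=> wM; have -> : w = series (telescope w) + cst (w 0%N).
  by rewrite telescopeK; apply/funext => n; rewrite fctE /= subrK.
apply: is_cvgD; last exact: is_cvg_cst.
apply: normed_cvg; apply: (@series_le_cvg _ _ (geometric M 2^-1)).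
- by move=> n; exact: normr_ge0.
- by move=> n; rewrite /geometric /= exprVn; apply: le_trans (wM n); exact: normr_ge0.
- by move=> n; rewrite /geometric /= exprVn; exact: wM.
- by apply: is_cvg_geometric_series; rewrite ger0_norm; lra.
Qed.

Section Completeness.
Context d (T : measurableType d) (R : realType) (mu : {measure set T -> \bar R}).

(* The weights [4 ^+ k] give geometric pointwise decay of the increments by
   monotone convergence alone, whether or not [mu] is finite. *)
Lemma ae_bounded_increments (D : nat -> T -> R) :
  (forall k, measurable_fun setT (D k)) -> (forall k x, 0 <= D k x) ->
  (forall k, \int[mu]_x (D k x)%:E <= ((4 ^+ k)^-1 / (2 ^ (k + 1))%:R)%:E)%E ->
  {ae mu, forall x, exists M, forall k, D k x <= M / 4 ^+ k}.
Proof.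
(* The weighted sum [h] has integral at most the sum of the [2 ^- (k + 1)], so it is finite almost
   everywhere; its value at [x] serves as [M]. *)
move=> mD D0 iD; pose h x := (\sum_(0 <= k <oo) (4 ^+ k * D k x)%:E)%E.
have mD4 k : measurable_fun setT (fun x => (4 ^+ k * D k x)%:E).
  by apply/measurable_EFinP/measurable_funM.
have D40 k x : (0 <= (4 ^+ k * D k x)%:E)%E by rewrite lee_fin mulr_ge0// exprn_ge0.
have ih : (\int[mu]_x h x < +oo)%E.
  rewrite integral_nneseries//.
  apply: (@le_lt_trans _ _ (\sum_(0 <= k <oo) (1 / (2 ^ (k + 1))%:R)%:E)%E).
    apply: lee_nneseries => k _; first by move=> _; exact: integral_ge0.
    under eq_integral do rewrite EFinM.
    rewrite ge0_integralZl//.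
    - apply: (@le_trans _ _ ((4 ^+ k)%:E * ((4 ^+ k)^-1 / (2 ^ (k + 1))%:R)%:E)%E).
        by rewrite lee_wpmul2l// lee_fin exprn_ge0.
      by rewrite -EFinM mulrA divff ?expf_neq0.
    - exact/measurable_EFinP.
    - by move=> *; rewrite lee_fin.
  have /cvg_lim := @cvg_geometric_eseries_half R 1 0.
  by move=> /= -> //; exact: ltry.
have mh : measurable_fun setT h.
  by apply: ge0_emeasurable_sum => // k x _ _; exact: D40.
have h0 x : (0 <= h x)%E by apply: nneseries_ge0.
have /integrable_ae : mu.-integrable setT h.
  by apply/integrableP; split => //; under eq_integral do rewrite gee0_abs//.
move=> /(_ measurableT); apply: filterS => x /(_ I) hx.
exists (fine (h x)) => k; rewrite ler_pdivlMr ?exprn_gt0// mulrC -lee_fin fineK//.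
apply: le_trans (@nneseries_lim_ge _ _ xpredT 0%N k.+1 _) => //.
rewrite big_nat_recr//=; apply: leeDr; exact: sume_ge0.
Qed.

Lemma nsq_represents (f : L2 mu) (F : T -> R[i]) :
  sq_integrable mu F -> represents f F ->
  (nsq f)%:E = (\int[mu]_x (normc2 (F x))%:E)%E.
Proof.
move=> [F1 F2 _] fF; have [f1 f2 _] := L2_sq_integrable f.
rewrite nsqE; apply: ae_eq_integral => //; [exact: measurable_normc2..|].
by apply: filterS fF => x ->.
Qed.

Lemma limn_einf_le (u : nat -> \bar R) (e : \bar R) N :
  (forall n, (N <= n)%N -> (u n <= e)%E) -> (limn_einf u <= e)%E.
Proof.
move=> ue; rewrite limn_einf_lim; apply: lime_le; first exact: is_cvg_einfs.
exists N => // n /= Nn; apply: le_trans (ue n Nn).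
by apply: ereal_inf_lbound; exists n => /=.
Qed.

(** A rapidly converging subsequence [v] converges almost everywhere. Fatou's lemma along [v] then
    yields both the square integrability of the limit and the convergence of the whole sequence
    [u]. *)
Lemma L2_complete (u : nat -> L2 mu) :
  (forall e : R, 0 < e -> exists N, forall m n, (N <= m)%N -> (N <= n)%N ->
     nsq (u m - u n) <= e) ->
  exists f, nsq (u n - f) @[n --> \oo] --> 0.
Proof.
(* The tolerance [c k] is the bound on increments that [ae_bounded_increments] expects. *)
move=> uC; pose c k : R := (4 ^+ k)^-1 / (2 ^ (k + 1))%:R.
have c0 k : 0 < c k by rewrite divr_gt0// ?invr_gt0 ?exprn_gt0// ltr0n expn_gt0.
have /choice[phi0 uphi0] k := uC _ (c0 k).
(* The maximum with [k] ensures [k <= psi k], so that [v] eventually lies in every tail of [u]. *)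
pose phi k := maxn (phi0 k) k.
have uphi k m n : (phi k <= m)%N -> (phi k <= n)%N -> nsq (u m - u n) <= c k.
  by rewrite !geq_max => /andP[? _] /andP[? _]; exact: uphi0.
(* The running maximum makes the indices nondecreasing, so [psi k.+1] is also beyond [phi k]. *)
pose psi k := (\max_(j < k.+1) phi j)%N.
have phi_psi k : (phi k <= psi k)%N by apply: (leq_bigmax (@ord_max k)).
have psiS k : (psi k <= psi k.+1)%N by rewrite [leqRHS]big_ord_recr leq_maxl.
pose v k := u (psi k).
have nv k : nsq (v k.+1 - v k) <= c k.
  by apply: uphi => //; exact: leq_trans (phi_psi k) _.
have sv k (g : L2 mu) : sq_integrable mu (fun x => g x - v k x).
  have := sq_integrable_lin (-1) (L2_sq_integrable (v k)) (L2_sq_integrable g).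
  by under eq_fun do rewrite mulN1r addrC.
have rv k (g : L2 mu) : represents (g - v k) (fun x => g x - v k x).
  exact: representsB (represents_self _) (represents_self _).
have mRe k := L2_measurable_Re (v k); have mIm k := L2_measurable_Im (v k).
pose D k x := normc2 (v k.+1 x - v k x).
have aeD : {ae mu, forall x, exists M, forall k, D k x <= M / 4 ^+ k}.
  apply: ae_bounded_increments.
  - by move=> k; have [? ? _] := sv k (v k.+1); apply/measurable_EFinP/measurable_normc2.
  - by move=> k x; exact: sqr_ge0.
  - by move=> k; rewrite -(nsq_represents (sv k _) (rv k _)) lee_fin; exact: nv.
have cvg_v : {ae mu, forall x, cvgn (fun k => Re (v k x)) /\ cvgn (fun k => Im (v k x))}.
  apply: filterS aeD => x [M DM].
  have M0 : 0 <= M by have := DM 0%N; rewrite divr1; apply: le_trans; exact: sqr_ge0.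
  (* [M <= (M + 1) ^ 2] replaces the square root of [M] by [M + 1]. *)
  have bnd (y : R) k : y ^+ 2 <= D k x -> `|y| <= (M + 1) / 2 ^+ k.
    move=> yD; rewrite -[leRHS]ger0_norm; last first.
      by rewrite divr_ge0 ?exprn_ge0// addr_ge0.
    rewrite -ler_sqr ?nnegrE// !real_normK ?num_real//.
    apply: le_trans yD _; apply: le_trans (DM k) _.
    rewrite expr_div_n -exprM mulnC exprM (_ : 2 ^+ 2 = 4 :> R); last by ring.
    by rewrite ler_wpM2r ?invr_ge0 ?exprn_ge0//; nra.
  split; apply: (@geometric_increments_cvg _ _ (M + 1)) => k; apply: bnd.
    by rewrite /D normc2B lerDl sqr_ge0.
  by rewrite /D normc2B lerDr sqr_ge0.
(* Upper limits exist and are measurable everywhere; off the null set where [v] diverges they are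
   the limits, and [fine] makes them real on that set too. *)
pose G x : R[i] := fine (limn_esup (fun k => (Re (v k x))%:E)) +i*
            fine (limn_esup (fun k => (Im (v k x))%:E)).
have mG1 : measurable_fun setT (fun x => Re (G x)).
  apply: measurableT_comp; first exact: fine_measurable.
  by apply: measurable_fun_limn_esup => k; apply/measurable_EFinP.
have mG2 : measurable_fun setT (fun x => Im (G x)).
  apply: measurableT_comp; first exact: fine_measurable.
  by apply: measurable_fun_limn_esup => k; apply/measurable_EFinP.
have cvgG : {ae mu, forall x, Re (v k x) @[k --> \oo] --> Re (G x) /\
                              Im (v k x) @[k --> \oo] --> Im (G x)}.
  have aux (w : nat -> R) : cvgn w ->
      w k @[k --> \oo] --> fine (limn_esup (fun k => (w k)%:E)).
    move=> cw; have /cvg_limn_einf_sup [_ ->] // :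
      (w k)%:E @[k --> \oo] --> (limn w)%:E by apply: cvg_EFin => //; exact: nearW.
  by apply: filterS cvg_v => x [c1 c2]; split; exact: aux.
have mvG (g : L2 mu) : measurable_fun setT (fun x => (normc2 (g x - G x))%:E).
  apply: measurable_normc2.
    under eq_fun do rewrite Re_add Re_opp.
    by apply: measurable_funB => //; exact: L2_measurable_Re.
  under eq_fun do rewrite Im_add Im_opp.
  by apply: measurable_funB => //; exact: L2_measurable_Im.
(* Applied twice: with [g = v 0] to see that [G] is square integrable, and with [g = u n] for the
   convergence of [u]. *)
have fatouG (g : L2 mu) e N : (forall k, (N <= k)%N -> nsq (g - v k) <= e) ->
    (\int[mu]_x (normc2 (g x - G x))%:E <= e%:E)%E.
  move=> ge; have mgv k : measurable_fun setT (fun x => (normc2 (g x - v k x))%:E).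
    by have [? ? _] := sv k g; exact: measurable_normc2.
  rewrite (@ae_eq_integral _ _ _ mu setT
    (fun x => limn_einf (fun k => (normc2 (g x - v k x))%:E)))//; last 2 first.
  - rewrite (_ : (fun x => _) =
        (fun x => - limn_esup (fun k => - (normc2 (g x - v k x))%:E))%E).
      apply: measurableT_comp => //; apply: measurable_fun_limn_esup => k.
      exact: measurableT_comp.
    apply/funext => x; rewrite -limn_einfN; congr limn_einf.
    by apply/funext => k; rewrite [RHS]oppeK.
  - apply: filterS cvgG => x [c1 c2] _; apply/esym.
    suff /cvg_limn_einf_sup[-> //] : (normc2 (g x - v k x))%:E @[k --> \oo] -->
      (normc2 (g x - G x))%:E.
    apply: cvg_EFin; first exact: nearW.
    rewrite [X in X @ _ --> _](_ : _ = (fun k =>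
        (Re (g x) - Re (v k x)) * (Re (g x) - Re (v k x)) +
        (Im (g x) - Im (v k x)) * (Im (g x) - Im (v k x)))); last first.
      by apply/funext => k; rewrite /= normc2B !expr2.
    by rewrite normc2B !expr2;
      apply: cvgD; apply: cvgM; apply: cvgB => //; exact: cvg_cst.
  apply: (le_trans (fatou mu measurableT mgv _)).
    by move=> n x _; rewrite lee_fin sqr_ge0.
  apply: (@limn_einf_le _ _ N) => k Nk; rewrite -(nsq_represents (sv k _) (rv k _)).
  by rewrite lee_fin ge.
have sG : sq_integrable mu G.
  pose g := v 0%N.
  suff sgG : sq_integrable mu (fun x => g x - G x).
    have := sq_integrable_lin (-1) sgG (L2_sq_integrable g).
    by congr sq_integrable; apply/funext => x; rewrite mulN1r opprB subrK.
  split.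
  - under eq_fun do rewrite Re_add Re_opp.
    by apply: measurable_funB => //; exact: L2_measurable_Re.
  - under eq_fun do rewrite Im_add Im_opp.
    by apply: measurable_funB => //; exact: L2_measurable_Im.
  apply: (@le_lt_trans _ _ (c 0%N)%:E); last exact: ltry.
  apply: (fatouG g _ 0%N) => k _; apply: uphi; first exact: phi_psi.
  by apply: leq_trans (phi_psi 0%N) _; elim: k => // k /leq_trans; apply.
have [f fG] := represents_ex sG; exists f.
apply/cvgrPdist_le => e e0; have [N uN] := uC e e0.
exists N => // n /= Nn; rewrite sub0r normrN ger0_norm ?nsq_ge0//.
have sG' : sq_integrable mu (fun x => u n x - G x).
  have := sq_integrable_lin (-1) sG (L2_sq_integrable (u n)).
  by under eq_fun do rewrite mulN1r addrC.
rewrite -lee_fin (nsq_represents sG' (representsB (represents_self (u n)) fG)).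
apply: (fatouG _ _ N) => k Nk; apply: uN => //.
by apply: leq_trans (phi_psi k); rewrite leq_max Nk orbT.
Qed.

End Completeness.

(** * Orthonormal families *)

Section Orthonormal.
Context d (T : measurableType d) (R : realType) (mu : {measure set T -> \bar R}).
Implicit Types (f g : L2 mu) (P : nat -> L2 mu) (a : nat -> R[i]).

Definition orthonormal P := forall i j, L2_ip (P i) (P j) = (i == j)%:R.

(** Totality as triviality of the orthogonal complement; for an orthonormal family, completeness
    turns it into convergence of expansions in [cvg_partial_sum]. *)
Definition is_total P := forall f, (forall n, L2_ip f (P n) = 0) -> f = 0.

Definition partial_sum P a N : L2 mu := \sum_(i < N) a i *: P i.

Lemma ip_partial_suml P a N g :
  L2_ip (partial_sum P a N) g = \sum_(i < N) a i * L2_ip (P i) g.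
Proof.
by rewrite /partial_sum (L2_ip_suml N (fun i => a i *: P i));
  apply: eq_bigr => i _; rewrite L2_ipZl.
Qed.

Lemma ip_partial_sumr P a N g :
  L2_ip g (partial_sum P a N) = \sum_(i < N) (a i)^* * L2_ip g (P i).
Proof.
rewrite L2_ipC ip_partial_suml (rmorph_sum conjc); apply: eq_bigr => i _.
by rewrite [LHS](rmorphM conjc) /= (L2_ipC (P i) g).
Qed.

Lemma ip_partial_sum P a N n : orthonormal P ->
  L2_ip (partial_sum P a N) (P n) = if (n < N)%N then a n else 0.
Proof.
move=> oP; rewrite ip_partial_suml; case: ltnP => nN.
  rewrite (bigD1 (Ordinal nN))//= oP eqxx mulr1 big1 ?addr0// => i ni.
  by rewrite oP (_ : (i == n :> nat) = false) ?mulr0//; exact: negbTE.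
rewrite big1// => i _; rewrite oP (_ : (i == n :> nat) = false) ?mulr0//.
by rewrite ltn_eqF// (leq_trans (ltn_ord i)).
Qed.

Lemma nsq_partial_sum P a N : orthonormal P ->
  nsq (partial_sum P a N) = \sum_(i < N) normc2 (a i).
Proof.
move=> oP; have: L2_ip (partial_sum P a N) (partial_sum P a N) =
    (\sum_(i < N) normc2 (a i))%:C.
  rewrite ip_partial_sumr rmorph_sum/=; apply: eq_bigr => i _.
  by rewrite ip_partial_sum// ltn_ord mulrC mulC_conj.
by rewrite L2_ipff => -[].
Qed.

(** Pythagoras: the partial sum is the orthogonal projection of [f] on the span of the first [N]
    vectors. *)
Lemma nsq_sub_partial_sum P f N : orthonormal P ->
  nsq (f - partial_sum P (fun n => L2_ip f (P n)) N) =
  nsq f - \sum_(i < N) normc2 (L2_ip f (P i)).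
Proof.
move=> oP; rewrite nsqB nsq_partial_sum// ip_partial_sumr.
rewrite (eq_bigr (fun i : 'I_N => (normc2 (L2_ip f (P i)))%:C)); last first.
  by move=> i _; rewrite mulrC mulC_conj.
by rewrite -(rmorph_sum (real_complex R)) /=; ring.
Qed.

Lemma bessel P f N : orthonormal P ->
  \sum_(i < N) normc2 (L2_ip f (P i)) <= nsq f.
Proof. by move=> oP; rewrite -subr_ge0 -nsq_sub_partial_sum// nsq_ge0. Qed.

(** Cauchy-Schwarz against a unit vector, from the nonnegative squared norm of [f] minus its
    projection on [g]. *)
Lemma normc2_ip_le f g : nsq g = 1 -> normc2 (L2_ip f g) <= nsq f.
Proof.
move=> g1; have := nsq_ge0 (f - L2_ip f g *: g).
by rewrite nsqB nsqZ g1 mulr1 L2_ipZr [_^* * _]mulrC mulC_conj /=; lra.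
Qed.

Lemma nsq_orthonormal P n : orthonormal P -> nsq (P n) = 1.
Proof. by move=> oP; rewrite /nsq oP eqxx. Qed.

(** The shorter sum is the truncated expansion of the longer one, so Pythagoras applies. *)
Lemma nsq_partial_sumB P a m n : orthonormal P ->
  nsq (partial_sum P a m - partial_sum P a n) =
  `|\sum_(i < m) normc2 (a i) - \sum_(i < n) normc2 (a i)|.
Proof.
move=> oP; wlog nm : m n / (n <= m)%N.
  move=> H; case: (leqP n m) => [|/ltnW]; first exact: H.
  by rewrite nsqBC distrC; exact: H.
have -> : partial_sum P a n =
    partial_sum P (fun i => L2_ip (partial_sum P a m) (P i)) n.
  apply: eq_bigr => i _; rewrite ip_partial_sum//.
  by rewrite (leq_trans (ltn_ord i)).
rewrite nsq_sub_partial_sum// nsq_partial_sum//.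
have -> : \sum_(i < n) normc2 (L2_ip (partial_sum P a m) (P i)) =
    \sum_(i < n) normc2 (a i).
  by apply: eq_bigr => i _; rewrite ip_partial_sum// (leq_trans (ltn_ord i)).
rewrite ger0_norm// subr_ge0 -!(big_mkord xpredT (fun i => normc2 (a i))).
by rewrite (big_cat_nat _ nm)//= lerDl sumr_ge0// => i _; exact: sqr_ge0.
Qed.

(** The Riesz-Fischer theorem: bounded sums of squares converge, hence the partial sums of the
    series are Cauchy in L2. *)
Lemma synthesis P a B : orthonormal P ->
  (forall N, \sum_(i < N) normc2 (a i) <= B) ->
  exists f, (forall n, L2_ip f (P n) = a n) /\
            nsq (partial_sum P a N - f) @[N --> \oo] --> 0.
Proof.
move=> oP aB; pose s N := \sum_(i < N) normc2 (a i).
have cs : cvgn s.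
  apply: nondecreasing_is_cvgn.
    apply/nondecreasing_seqP => n; rewrite /s big_ord_recr/= lerDl.
    exact: sqr_ge0.
  by exists B => _ [N _ <-]; exact: aB.
have [|f fP] := @L2_complete _ _ _ mu (partial_sum P a).
  move=> e e0; have /cvgrPdist_le /(_ (e / 2)) := cs.
  case; first by rewrite divr_gt0.
  move=> N _ sN; exists N => m n Nm Nn; rewrite nsq_partial_sumB//.
  have := sN m Nm; have := sN n Nn; rewrite -/(s m) -/(s n) => h1 h2.
  apply: le_trans (ler_distD (limn s) _ _) _.
  by rewrite [X in X + _]distrC (splitr e) lerD.
exists f; split => // n.
apply/eqP; rewrite -subr_eq0; apply/eqP/normc2_eq0.
apply/eqP; rewrite eq_le sqr_ge0 andbT.
rewrite -(cvg_lim _ fP)//; apply: limr_ge; first exact: cvgP fP.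
(* From [n.+1] on, the [n]-th coefficient of the partial sum is exactly [a n], so the distance to
   the limit bounds the error on that coefficient. *)
exists n.+1 => // N /= nN; rewrite nsqBC.
apply: le_trans (normc2_ip_le _ (nsq_orthonormal n oP)).
by rewrite L2_ipBl ip_partial_sum// nN.
Qed.

Lemma total_ext P f g : is_total P ->
  (forall n, L2_ip f (P n) = L2_ip g (P n)) -> f = g.
Proof.
move=> tP fg; apply/eqP; rewrite -subr_eq0; apply/eqP; apply: tP => n.
by rewrite L2_ipBl fg subrr.
Qed.

(** The sums converge to some element with the coefficients of [f], which totality identifies with
    [f]. *)
Lemma cvg_partial_sum P f : orthonormal P -> is_total P ->
  nsq (partial_sum P (fun n => L2_ip f (P n)) N - f) @[N --> \oo] --> 0.
Proof.
move=> oP tP.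
have [g [gP]] := synthesis (a := fun n => L2_ip f (P n)) oP (fun N => bessel f N oP).
by rewrite (total_ext tP gP).
Qed.

Lemma parseval P f : orthonormal P -> is_total P ->
  \sum_(i < N) normc2 (L2_ip f (P i)) @[N --> \oo] --> nsq f.
Proof.
move=> oP tP; have := @cvg_partial_sum P f oP tP.
under eq_fun do rewrite nsqBC nsq_sub_partial_sum//.
move=> /(cvgB (cvg_cst (nsq f))); rewrite subr0.
by apply: cvg_trans; apply: near_eq_cvg; apply: nearW => N; rewrite !fctE; ring.
Qed.

End Orthonormal.

(** * Isometries between orthonormal bases *)

Section BasisIsometry.
Context d1 d2 (S : measurableType d1) (T : measurableType d2) (R : realType).
Context (mu : {measure set S -> \bar R}) (nu : {measure set T -> \bar R}).

(** Polarization recovers the real part of the inner product; the imaginary part follows from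
    [Im z = Re (- i z)]. *)
Lemma isometry_ip (U : {linear L2 mu -> L2 nu}) :
  (forall f, nsq (U f) = nsq f) -> forall f g, L2_ip (U f) (U g) = L2_ip f g.
Proof.
move=> iU; have iRe f g : Re (L2_ip (U f) (U g)) = Re (L2_ip f g).
  by have := iU (f + g); rewrite raddfD !nsqD !iU; lra.
have ImE (z : R[i]) : Im z = Re ((- 'i) * z).
  by case: z => p q /=; ring.
move=> f g; have := iRe f g; have := iRe (- 'i *: f) g.
rewrite linearZ_LR !L2_ipZl -!ImE.
by case: (L2_ip _ _) (L2_ip _ _) => [? ?] [? ?] /= -> ->.
Qed.

(** Bessel's inequality lets [synthesis] build an image with the same coefficients. Linearity is
    uniqueness of coefficients, and isometry is Parseval's identity on both sides. *)
Lemma basis_isometry (P : nat -> L2 mu) (Q : nat -> L2 nu) :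
  orthonormal P -> is_total P -> orthonormal Q -> is_total Q ->
  exists U : {linear L2 mu -> L2 nu},
    [/\ forall f n, L2_ip (U f) (Q n) = L2_ip f (P n),
        forall n, U (P n) = Q n & forall f, nsq (U f) = nsq f].
Proof.
move=> oP tP oQ tQ.
have /choice[U UE] f : exists g, forall n, L2_ip g (Q n) = L2_ip f (P n).
  have [g [gQ _]] :=
    synthesis (a := fun n => L2_ip f (P n)) oQ (fun N => bessel f N oP).
  by exists g.
have Ulin : linear U.
  by move=> a f g; apply: (total_ext tQ) => n; rewrite L2_ip_lin !UE L2_ip_lin.
pose mU := GRing.isLinear.Build _ _ _ _ U Ulin.
pose V : {linear L2 mu -> L2 nu} := HB.pack U mU.
exists V; split => // [n|f].
  by apply: (total_ext tQ) => m; rewrite UE oP oQ.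
have := @parseval _ _ _ _ P f oP tP; have := @parseval _ _ _ _ Q (U f) oQ tQ.
under eq_fun do under eq_bigr do rewrite UE.
by move=> h1 h2; exact: (cvg_unique _ h1 h2).
Qed.

(** The operators agree on partial sums, and boundedness carries the agreement to the limit. This is
    the uniqueness of the extension of [U] from the basis. *)
Lemma bounded_op_ext (P : nat -> L2 mu) (U V : {linear L2 mu -> L2 nu}) :
  orthonormal P -> is_total P -> bounded_op U -> bounded_op V ->
  (forall n, U (P n) = V (P n)) -> U =1 V.
Proof.
move=> oP tP [cU bU] [cV bV] UV f.
have bnd (W : {linear L2 mu -> L2 nu}) c :
    (forall f, L2_norm (W f) <= c * L2_norm f) ->
    forall f, nsq (W f) <= c ^+ 2 * nsq f.
  move=> Wc g; have := Wc g; rewrite !L2_normE => Wg.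
  rewrite -[leLHS]sqr_sqrtr ?nsq_ge0// -[in leRHS](@sqr_sqrtr _ (nsq g)) ?nsq_ge0//.
  (* No sign is known for [c]; [Wg] itself shows that its right side is nonnegative, so both sides
     can be squared. *)
  by rewrite -exprMn ler_sqr ?nnegrE// (le_trans _ Wg).
have UVs N a : U (partial_sum P a N) = V (partial_sum P a N).
  by rewrite /partial_sum !linear_sum; apply: eq_bigr => i _; rewrite !linearZ /= UV.
apply/eqP; rewrite -subr_eq0; apply/eqP/nsq_eq0/eqP; rewrite eq_le nsq_ge0 andbT.
pose s N := nsq (partial_sum P (fun n => L2_ip f (P n)) N - f).
have s0 : (2 * cU ^+ 2 + 2 * cV ^+ 2) * s N @[N --> \oo] --> 0.
  rewrite -[X in _ --> X](mulr0 (2 * cU ^+ 2 + 2 * cV ^+ 2)).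
  by apply: cvgMr; exact: cvg_partial_sum.
rewrite -(cvg_lim _ s0)//; apply: limr_ge; first exact: cvgP s0.
apply: nearW => N; pose g := partial_sum P (fun n => L2_ip f (P n)) N - f.
have -> : U f - V f = V g - U g.
  have gW (W : {linear L2 mu -> L2 nu}) :
      W g = W (partial_sum P (fun n => L2_ip f (P n)) N) - W f := raddfB W _ _.
  by rewrite !gW UVs opprB [RHS]addrC subrKA.
apply: le_trans (nsqD_le _ _) _; rewrite nsqN /s -/g.
by have := bnd _ _ bU g; have := bnd _ _ bV g; lra.
Qed.

End BasisIsometry.

Section Unitary.
Context d1 d2 (S : measurableType d1) (T : measurableType d2) (R : realType).
Context (mu : {measure set S -> \bar R}) (nu : {measure set T -> \bar R}).

(** [adjoint] is chosen among all adjoints, so one is exhibited, namely the isometry [V] that sends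
    [Q] back to [P]. Testing against [P n] then shows that the chosen adjoint equals [V]. *)
Lemma unitary_of_basis (P : nat -> L2 mu) (Q : nat -> L2 nu)
    (U : {linear L2 mu -> L2 nu}) :
  orthonormal P -> is_total P -> orthonormal Q -> is_total Q ->
  (forall n, U (P n) = Q n) -> (forall f, nsq (U f) = nsq f) -> unitary U.
Proof.
move=> oP tP oQ tQ UP iU.
have [V [VE _ _]] := basis_isometry oQ tQ oP tP.
have ipU := isometry_ip iU.
have UK : cancel U V.
  by move=> f; apply: (total_ext tP) => n; rewrite VE -UP ipU.
have VK : cancel V U.
  by move=> g; apply: (total_ext tQ) => n; rewrite -UP ipU VE UP.
have adjV : is_adjoint U V by move=> f g; rewrite -[in LHS](VK g) ipU.
have adjW : is_adjoint U (adjoint U).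
  by apply: (xgetPex (fun=> 0)); exists (V : L2 nu -> L2 mu).
have WV : adjoint U =1 V.
  move=> g; apply: (total_ext tP) => n.
  by rewrite L2_ipC -adjW adjV -L2_ipC.
by split => // f; rewrite WV.
Qed.

End Unitary.

(** * The standard basis of l2 *)

Section Ell2.
Variable R : realType.
Local Notation mu := (@counting nat R).

Lemma counting_set1 (n : nat) : mu [set n] = 1%E.
Proof.
rewrite /counting; case: asboolP => [fn|]; last by case; exact: finite_set1.
by rewrite fset_set1 finmap.cardfs1.
Qed.

Lemma Rintegral_counting_point (n : nat) (c : R) :
  \int[mu]_m (c * (m == n)%:R) = c.
Proof.
rewrite (@eq_Rintegral _ _ _ mu setT (fun m => c * \1_[set n] m)); last first.
  by move=> m _; rewrite indicE in_set1.
have int1 : (\int[mu]_m (\1_[set n] m : R)%:E = 1)%E.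
  by rewrite integral_indic// setIT; exact: counting_set1.
rewrite RintegralZl//; first by rewrite /Rintegral int1 mulr1.
apply/integrableP; split; first exact/measurable_EFinP.
under eq_integral do rewrite gee0_abs ?lee_fin//.
by rewrite int1 ltry.
Qed.

Lemma ip_ell2_basis (f : ell2 R) n : L2_ip f (ell2_basis R n) = f n.
Proof.
have e (m : nat) : f m * (ell2_basis R n m)^* =
    (Re (f n) * (m == n)%:R) +i* (Im (f n) * (m == n)%:R).
  rewrite ell2_basisE; case: eqVneq => [->|_].
    by case: (f n) => p q /=; congr (_ +i* _); ring.
  by case: (f m) => p q /=; congr (_ +i* _); ring.
rewrite /L2_ip; under eq_Rintegral do rewrite e.
rewrite Rintegral_counting_point.
under eq_Rintegral do rewrite e.
by rewrite Rintegral_counting_point; case: (f n).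
Qed.

Lemma ell2_basis_orthonormal : orthonormal (ell2_basis R).
Proof. by move=> i j; rewrite ip_ell2_basis ell2_basisE eq_sym. Qed.

Lemma ell2_basis_total : is_total (ell2_basis R).
Proof.
move=> f f0; apply: (represents_inj (represents_self f)).
apply: represents_ae (represents0 mu) _.
by apply: nearW => n; rewrite -ip_ell2_basis f0.
Qed.
End Ell2.

(** * Totality of the polynomials *)

Section ExpBounds.
Context (R : realType).
Implicit Types (x e : R) (p : {poly R}).

Lemma norm_le_exp_sqr e : 0 < e ->
  exists2 C, 0 <= C & forall x, `|x| <= C * expR (e * x ^+ 2).
Proof.
move=> e0; exists (1 + e^-1); first by rewrite addr_ge0// invr_ge0 ltW.
(* With the factor [1 + e^-1], the product with [1 + e x^2] contains [1 + x^2], which dominates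
   [|x|]. *)
move=> x; have h := expR_ge1Dx (e * x ^+ 2).
apply: (@le_trans _ _ ((1 + e^-1) * (1 + e * x ^+ 2))); last first.
  by rewrite ler_wpM2l// addr_ge0// invr_ge0 ltW.
have -> : (1 + e^-1) * (1 + e * x ^+ 2) = 1 + e^-1 + e * x ^+ 2 + x ^+ 2.
  by field; rewrite gt_eqF.
have : 0 <= e^-1 by rewrite invr_ge0 ltW.
have : 0 <= e * x ^+ 2 by rewrite mulr_ge0 ?sqr_ge0// ltW.
have : 0 <= (`|x| - 1) ^+ 2 by exact: sqr_ge0.
rewrite -(real_normK (num_real x)); have := normr_ge0 x; nra.
Qed.

Lemma poly_le_exp_sqr p e : 0 < e ->
  exists2 C, 0 <= C & forall x, `|p.[x]| <= C * expR (e * x ^+ 2).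
Proof.
elim/poly_ind: p e => [|p a IH] e e0.
  by exists 0 => // x; rewrite horner0 normr0 mul0r.
(* Each Horner step halves the exponent: one half pays for the factor ['X], the other for the
   remaining polynomial. *)
have e20 : 0 < e / 2 by rewrite divr_gt0.
have [C C0 pC] := IH _ e20; have [D D0 xD] := norm_le_exp_sqr e20.
exists (C * D + `|a|); first by rewrite addr_ge0// mulr_ge0.
move=> x; rewrite hornerMXaddC mulrDl; apply: le_trans (ler_normD _ _) _.
apply: lerD; last first.
  by rewrite ler_peMr// -expR0 ler_expR mulr_ge0 ?sqr_ge0// ltW.
have -> : e * x ^+ 2 = e / 2 * x ^+ 2 + e / 2 * x ^+ 2 by field.
by rewrite expRD normrM mulrACA ler_pM.
Qed.

(** A bound uniform in [N], which provides the domination when the exponential series is integrated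
    term by term. *)
Lemma exp_partial_sum_le x N : `|series (exp_coeff x) N| <= expR `|x|.
Proof.
apply: (@le_trans _ _ (series (exp_coeff `|x|) N)).
  rewrite /series/=; apply: le_trans (ler_norm_sum _ _ _) _.
  apply: ler_sum => i _; rewrite /exp_coeff/= normrM normrX normfV.
  by rewrite [X in _ / X]ger0_norm.
apply: nondecreasing_cvgn_le; last exact: is_cvg_series_exp_coeff.
apply/nondecreasing_seqP => n; rewrite /series/= big_nat_recr//= lerDl.
by rewrite /exp_coeff/= divr_ge0// exprn_ge0.
Qed.

End ExpBounds.

(** * Polynomial approximation of a step function *)

Section Threshold.
Context (R : realType).
Implicit Types z : R.

Lemma cvg_expr_gt1 z : 1 < z -> (z ^+ n)^-1 @[n --> \oo] --> (0 : R).
Proof.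
move=> z1; under eq_fun do rewrite -exprVn.
by apply: cvg_expr; rewrite ger0_norm ?invr_ge0 ?invf_lt1//; lra.
Qed.

Lemma bernoulli_ge t N : 0 <= t <= 1 -> 1 - N%:R * t <= (1 - t) ^+ N :> R.
Proof.
move=> /andP[t0 t1]; elim: N => [|N IH]; first by rewrite expr0; lra.
apply: (@le_trans _ _ ((1 - t) * (1 - N%:R * t))).
  by rewrite -natr1; have : 0 <= N%:R :> R by []; nra.
by rewrite exprS ler_wpM2l// subr_ge0.
Qed.

(** Combines [(1 - t) (1 + t) <= 1] with Bernoulli's inequality for [1 + t]. *)
Lemma bernoulli_le t N : 0 <= t <= 1 -> (1 - t) ^+ N <= (1 + N%:R * t)^-1 :> R.
Proof.
move=> /andP[t0 t1].
have B : 1 + N%:R * t <= (1 + t) ^+ N.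
  elim: N => [|N IH]; first by rewrite expr0; lra.
  apply: (@le_trans _ _ ((1 + t) * (1 + N%:R * t))).
    by rewrite -natr1; have : 0 <= N%:R :> R by []; nra.
  by rewrite exprS ler_wpM2l// addr_ge0.
have N0 : 0 <= N%:R * t by rewrite mulr_ge0.
rewrite -[leRHS]mul1r ler_pdivlMr; last by lra.
apply: (@le_trans _ _ ((1 - t) ^+ N * (1 + t) ^+ N)).
  by rewrite ler_wpM2l// exprn_ge0// subr_ge0.
by rewrite -exprMn exprn_ile1//; nra.
Qed.

(** These polynomials are familiar from elementary proofs of the Stone-Weierstrass theorem. Below
    1/2 the expression is at most [(2 z) ^ n], which tends to 0. *)
Lemma cvg_threshold_lt z : 0 <= z < 2^-1 ->
  1 - (1 - z ^+ n) ^+ (2 ^ n) @[n --> \oo] --> (0 : R).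
Proof.
move=> /andP[z0 z1].
have h (n : nat) : 0 <= 1 - (1 - z ^+ n) ^+ (2 ^ n) <= (2 * z) ^+ n.
  have zn : 0 <= z ^+ n <= 1 by rewrite exprn_ge0//= exprn_ile1//; lra.
  rewrite subr_ge0 exprn_ile1 ?lerBlDr -?lerBlDl; try lra.
  by rewrite exprMn -natrX bernoulli_ge.
apply: (squeeze_cvgr (nearW _ h)); first exact: cvg_cst.
by apply: cvg_expr; rewrite ger0_norm; lra.
Qed.

(** Above 1/2 the distance to 1 is at most the inverse of [(2 z) ^ n], which now tends to
    infinity. *)
Lemma cvg_threshold_gt z : 2^-1 < z <= 1 ->
  1 - (1 - z ^+ n) ^+ (2 ^ n) @[n --> \oo] --> (1 : R).
Proof.
move=> /andP[z0 z1].
have h (n : nat) : 0 <= (1 - z ^+ n) ^+ (2 ^ n) <= ((2 * z) ^+ n)^-1.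
  have zn : 0 <= z ^+ n <= 1 by rewrite exprn_ge0 ?exprn_ile1//; lra.
  have zn0 : 0 < (2 * z) ^+ n by rewrite exprn_gt0//; lra.
  rewrite exprn_ge0 ?subr_ge0 ?(andP zn).2//=; apply: le_trans (bernoulli_le _ zn) _.
  rewrite natrX -exprMn lef_pV2 ?posrE//; lra.
rewrite -[X in _ --> X]subr0; apply: cvgB; first exact: cvg_cst.
apply: (squeeze_cvgr (nearW _ h)); first exact: cvg_cst.
by apply: cvg_expr_gt1; lra.
Qed.

End Threshold.

(** * Functions orthogonal to all polynomials *)

Section PolynomialDensity.
Local Open Scope ereal_scope.
Context (R : realType) (mu : {measure set (measurableTypeR R) -> \bar R}).
Context (c : R) (F : measurableTypeR R -> R).
Context (c_gt0 : (0 < c)%R).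
Context (exp_moment : \int[mu]_x (expR (c * x ^+ 2))%:E < +oo).
Context (mF : measurable_fun setT F).
Context (F_sq : \int[mu]_x (F x ^+ 2)%:E < +oo).

Let measurable_horner (p : {poly R}) :
  measurable_fun setT (fun x : measurableTypeR R => p.[x]).
Proof. exact: measurable_poly. Qed.

Let measurable_exp_sqr (a : R) :
  measurable_fun setT (fun x : measurableTypeR R => expR (a * x ^+ 2)).
Proof.
by apply: measurableT_comp => //; apply: measurable_funM => //; exact: measurable_funX.
Qed.

(* [|F u| <= F ^+ 2 + u ^+ 2] *)
Let integrable_dominated (u : measurableTypeR R -> R) C :
  measurable_fun setT u -> (forall x, `|u x| <= C * expR (c / 2 * x ^+ 2))%R ->
  mu.-integrable setT (fun x => (F x * u x)%:E).
Proof.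
move=> mu_ uC.
have mF2 : measurable_fun setT (fun x => (F x ^+ 2)%:E).
  by apply/measurable_EFinP; exact: measurable_funX.
have mE : measurable_fun setT (fun x : measurableTypeR R => (expR (c * x ^+ 2))%:E).
  by apply/measurable_EFinP; exact: measurable_exp_sqr.
have iF : mu.-integrable setT (fun x => (F x ^+ 2)%:E).
  apply/integrableP; split => //.
  by under eq_integral do rewrite gee0_abs ?lee_fin ?sqr_ge0//.
have iE : mu.-integrable setT (fun x : measurableTypeR R => (expR (c * x ^+ 2))%:E).
  apply/integrableP; split => //.
  by under eq_integral do rewrite gee0_abs ?lee_fin ?expR_ge0//.
have iD := integrableD measurableT iF (integrableZl measurableT (C ^+ 2) iE).
apply: le_integrable iD => //.
  by apply/measurable_EFinP; exact: measurable_funM.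
move=> x _ /=; rewrite lee_fin [leRHS]ger0_norm; last first.
  by rewrite addr_ge0 ?sqr_ge0// mulr_ge0 ?sqr_ge0// expR_ge0.
(* Squaring the bound on [u] doubles its exponent [c / 2], reaching exactly the exponential moment
   assumed finite. *)
have -> : (c * x ^+ 2 = c / 2 * x ^+ 2 + c / 2 * x ^+ 2)%R by field.
rewrite expRD -expr2 -exprMn; set w := (C * _)%R.
apply: (@le_trans _ _ (`|F x| ^+ 2 + `|u x| ^+ 2)%R).
  rewrite normrM; have := sqr_ge0 (`|F x| - `|u x|)%R.
  have := normr_ge0 (F x); have := normr_ge0 (u x); nra.
rewrite [(`|F x| ^+ 2)%R]real_normK ?num_real// lerD2l.
by apply: lerXn2r; rewrite ?nnegrE ?uC//; apply: le_trans (uC x).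
Qed.

Let iF : mu.-integrable setT (fun x => (F x)%:E).
Proof.
have := @integrable_dominated (cst 1%R) 1%R (measurable_cst _).
under [X in mu.-integrable _ X]eq_fun do rewrite mulr1.
apply => x; rewrite normr1 mul1r -expR0 ler_expR.
by rewrite mulr_ge0 ?sqr_ge0// divr_ge0// ltW.
Qed.

Context (F_orth : forall p : {poly R}, \int[mu]_x (F x * p.[x])%:E = 0).

Section PolynomialExponent.
(** Abstracts the quadratic [(x - a) (x - b)]. The lower bound [- D] makes [y] bounded; the upper
    bound on [|g|] with [8 * l <= c] gives growth at most [exp (c / 4 x^2)] for [exp |l g|], leaving
    another [c / 4] for a polynomial factor. *)
Context (g : {poly R}) (l D E : R).
Context (l_ge0 : (0 <= l)%R).
Context (l_small : (8 * l <= c)%R).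
Context (g_ge : forall x, (- D <= g.[x])%R).
Context (g_le : forall x, (`|g.[x]| <= 2 * x ^+ 2 + E)%R).

Let y (x : measurableTypeR R) : R := expR (- (l * g.[x])).

Let measurable_y : measurable_fun setT y.
Proof.
apply: measurableT_comp => //; apply: measurableT_comp => //.
by apply: measurable_funM => //; exact: measurable_horner.
Qed.

Let y_ge0 x : (0 <= y x)%R. Proof. exact: expR_ge0. Qed.

Let y_le x : (y x <= expR (l * D))%R.
Proof. by rewrite ler_expR -mulrN ler_wpM2l// lerNl. Qed.

(** One factor [y] is replaced by its Taylor polynomials, which are absorbed into [P]; the other [m]
    factors stay as they are and are bounded. The condition on [l] is therefore the same for every
    [m]. *)
Lemma orth_exp m (P : {poly R}) : \int[mu]_x (F x * (P.[x] * y x ^+ m))%:E = 0.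
Proof.
elim: m P => [|m IH] P.
  by under eq_integral do rewrite expr0 mulr1; exact: F_orth.
pose Q N : {poly R} := (\sum_(0 <= j < N) (j`!%:R)^-1 *: (- l *: g) ^+ j)%R.
have QE N x : (Q N).[x] = series (exp_coeff (- (l * g.[x]))) N.
  rewrite /Q horner_sum /series/=; apply: eq_bigr => j _.
  by rewrite hornerZ horner_exp hornerZ /exp_coeff/= mulNr mulrC.
pose f_ N (x : measurableTypeR R) := (F x * ((P * Q N).[x] * y x ^+ m))%:E.
pose f (x : measurableTypeR R) := (F x * (P.[x] * y x ^+ m.+1))%:E.
have my k : measurable_fun setT (fun x => y x ^+ k)%R by exact: measurable_funX.
(* [F * G] dominates every [f_ N], since the partial sums of the exponential of [- (l g)] are at
   most [exp |l g|]. *)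
pose G (x : measurableTypeR R) := (P.[x] * (y x ^+ m * expR `|l * g.[x]|))%R.
have mG : measurable_fun setT G.
  apply: measurable_funM => //; apply: measurable_funM => //.
  apply: measurableT_comp => //; apply: measurableT_comp => //.
  exact: measurable_funM.
have c4 : (0 < c / 4)%R by rewrite divr_gt0.
have [C C0 PC] := poly_le_exp_sqr P c4.
have iG : mu.-integrable setT (fun x => (F x * G x)%:E).
  apply: (@integrable_dominated _ (C * (expR (l * D) ^+ m * expR (l * E)))%R) => // x.
  rewrite /G normrM [X in (_ * X)%R]ger0_norm; last first.
    by rewrite mulr_ge0 ?exprn_ge0 ?expR_ge0.
  have -> : (c / 2 * x ^+ 2 = c / 4 * x ^+ 2 + c / 4 * x ^+ 2)%R by field.
  have ym : (y x ^+ m <= expR (l * D) ^+ m)%R.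
    by apply: lerXn2r; rewrite ?nnegrE ?expR_ge0 ?y_le.
  have gx : (expR `|l * g.[x]| <= expR (l * E) * expR (c / 4 * x ^+ 2))%R.
    rewrite -expRD ler_expR normrM ger0_norm//.
    apply: (@le_trans _ _ (l * (2 * x ^+ 2 + E))%R); first by rewrite ler_wpM2l.
    rewrite mulrDr addrC lerD2l mulrA ler_wpM2r ?sqr_ge0//.
    by move: l_small; lra.
  rewrite expRD mulrACA; apply: ler_pM => //.
    by rewrite mulr_ge0 ?exprn_ge0 ?expR_ge0.
  rewrite -[leRHS]mulrA; exact: (ler_pM (exprn_ge0 _ (y_ge0 _)) (expR_ge0 _) ym gx).
have [|||||_ _] := @dominated_convergence _ _ _ mu setT measurableT f_ f
    (fun x => `|(F x * G x)%:E|).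
- move=> N; apply/measurable_EFinP; apply: measurable_funM => //.
  exact: measurable_funM.
- by apply/measurable_EFinP; apply: measurable_funM => //; apply: measurable_funM.
- apply: nearW => x _; apply: cvg_EFin; first exact: nearW.
  rewrite [X in X @ _ --> _](_ : _ = (fun N => (F x * P.[x] * y x ^+ m) *
     series (exp_coeff (- (l * g.[x])%R)) N)%R); last first.
    by apply/funext => N; rewrite /= hornerM QE; ring.
  rewrite [X in _ --> X](_ : _ = (F x * P.[x] * y x ^+ m) * y x)%R; last first.
    by rewrite exprSr; ring.
  by apply: cvgMr; exact: is_cvg_series_exp_coeff.
- exact: integrable_abse.
- apply: nearW => x N _; rewrite lee_fin /G !normrM hornerM normrM.
  rewrite ler_wpM2l// -mulrA ler_wpM2l// mulrC ler_wpM2l//.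
  rewrite QE; apply: le_trans (exp_partial_sum_le _ _) _.
  by rewrite normrN normrM [leRHS]ger0_norm ?expR_ge0.
rewrite (_ : [sequence _]_n = cst 0); last by apply/funext => N; exact: IH.
by move=> /(cvg_lim (@ereal_hausdorff _)); rewrite lim_cst//.
Qed.

Let integrable_bounded (u : measurableTypeR R -> R) C :
  measurable_fun setT u -> (forall x, `|u x| <= C)%R ->
  mu.-integrable setT (fun x => (F x * u x)%:E).
Proof.
move=> mu_ uC; apply: (integrable_dominated mu_ (C := C)) => x.
apply: le_trans (uC x) _; rewrite ler_peMr//.
  by apply: le_trans (uC x).
by rewrite -expR0 ler_expR mulr_ge0 ?sqr_ge0// divr_ge0// ltW.
Qed.

Lemma orth_horner_exp (q : {poly R}) a :
  \int[mu]_x (F x * q.[a * y x])%:E = 0.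
Proof.
(* The additional power of [y] absorbs the variable released by each Horner step on [q]. *)
suff H m : \int[mu]_x (F x * (q.[a * y x] * y x ^+ m))%:E = 0.
  by rewrite -(H 0%N); apply: eq_integral => x _; rewrite expr0 mulr1.
have my k : measurable_fun setT (fun x => y x ^+ k)%R by exact: measurable_funX.
have may : measurable_fun setT (fun x => a * y x)%R by exact: measurable_funM.
have mq (p : {poly R}) : measurable_fun setT (fun x => p.[a * y x])%R.
  exact: (measurableT_comp (measurable_horner p) may).
have yA k x : (`|y x ^+ k| <= expR (l * D) ^+ k)%R.
  rewrite ger0_norm ?exprn_ge0//.
  by apply: lerXn2r; rewrite ?nnegrE ?expR_ge0 ?y_le.
have bq (p : {poly R}) : exists C, forall x, (`|p.[a * y x]| <= C)%R.
  elim/poly_ind: p => [|p b [C pC]].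
    by exists 0%R => x; rewrite horner0 normr0.
  exists (C * (`|a| * expR (l * D)) + `|b|)%R => x.
  rewrite hornerMXaddC; apply: le_trans (ler_normD _ _) _.
  rewrite lerD2r !normrM; apply: ler_pM; rewrite ?mulr_ge0 ?pC//.
  by rewrite ler_wpM2l//; have := yA 1%N x; rewrite !expr1.
elim/poly_ind: q m => [|q b IH] m.
  by under eq_integral do rewrite horner0 mul0r mulr0; rewrite integral0.
have [C qC] := bq q.
have iq k : mu.-integrable setT (fun x => (F x * (q.[a * y x] * y x ^+ k))%:E).
  apply: (@integrable_bounded _ (C * expR (l * D) ^+ k)%R).
    exact: measurable_funM.
  by move=> x; rewrite normrM; apply: ler_pM; rewrite ?qC ?yA.
have iy k : mu.-integrable setT (fun x => (F x * y x ^+ k)%:E).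
  exact: (@integrable_bounded _ (expR (l * D) ^+ k)%R).
have -> : (\int[mu]_x (F x * ((q * 'X + b%:P).[a * y x] * y x ^+ m))%:E =
    \int[mu]_x (a%:E * (F x * (q.[a * y x] * y x ^+ m.+1))%:E +
                b%:E * (F x * y x ^+ m)%:E)).
  apply: eq_integral => x _; rewrite hornerMXaddC -!EFinM -EFinD; congr EFin.
  by rewrite exprS; ring.
rewrite integralD//; [|exact: integrableZl..].
rewrite !integralZl// IH mule0 add0e.
rewrite -[X in _ * X = _](_ : \int[mu]_x (F x * (1%:P.[x] * y x ^+ m))%:E = _).
  by rewrite orth_exp mule0.
by apply: eq_integral => x _; rewrite hornerC mul1r.
Qed.

End PolynomialExponent.

Context (atomless : forall x, mu [set x] = 0).

(** [z = y / 2] equals 1/2 at the endpoints, is larger between them and smaller outside. The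
    threshold polynomials of [z] thus converge to the indicator off the two endpoints, which are
    null, and they stay in [[0, 1]]. *)
Lemma orth_itv (a b : R) : (a < b)%R ->
  \int[mu]_(x in `]a, b[%classic) (F x)%:E = 0.
Proof.
move=> ab; pose g : {poly R} := (('X - a%:P) * ('X - b%:P))%R.
have gE x : g.[x] = ((x - a) * (x - b))%R by rewrite hornerM !hornerXsubC.
(* [- D] is the minimum of [g], attained at the midpoint; [E] comes from
   [|(a + b) x| <= x^2 + (a + b)^2]. *)
pose D : R := ((b - a) ^+ 2 / 4)%R; pose E : R := ((a + b) ^+ 2 + `|a * b|)%R.
have g_ge x : (- D <= g.[x])%R.
  rewrite gE /D; have := sqr_ge0 (x - (a + b) / 2)%R; nra.
have g_le x : (`|g.[x]| <= 2 * x ^+ 2 + E)%R.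
  rewrite gE (_ : (x - a) * (x - b) = x ^+ 2 - (a + b) * x + a * b)%R; last by ring.
  apply: le_trans (ler_normD _ _) _; rewrite /E addrA lerD2r ler_norml.
  have := sqr_ge0 (x - (a + b))%R; have := sqr_ge0 (x + (a + b))%R.
  have := sqr_ge0 x; have := sqr_ge0 (a + b)%R.
  by move=> *; apply/andP; split; nra.
have D0 : (0 < D)%R by rewrite divr_gt0// exprn_gt0// subr_gt0.
(* The first bound is for domination; the second gives [y <= exp (1/2) <= 2], that is, [z <= 1]. *)
pose l : R := Num.min (c / 8)%R (2^-1 / D)%R.
have l0 : (0 < l)%R.
  by rewrite lt_min; apply/andP; split; apply: divr_gt0; rewrite ?invr_gt0.
have lc : (8 * l <= c)%R by rewrite mulrC -ler_pdivlMr// ge_min lexx.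
have lD : (l * D <= 2^-1)%R by rewrite -ler_pdivlMr// ge_min lexx orbT.
pose z (x : measurableTypeR R) : R := (2^-1 * expR (- (l * g.[x])))%R.
have z0 x : (0 <= z x)%R by rewrite mulr_ge0 ?expR_ge0.
have z1 x : (z x <= 1)%R.
  (* Invert [1 - 1/2 <= exp (- 1/2)]. *)
  have e2 : (expR (2^-1 : R) <= 2)%R.
    have := expR_ge1Dx (- 2^-1 : R); rewrite expRN => h.
    by rewrite -[leLHS]invrK -[leRHS]invrK lef_pV2 ?posrE ?invr_gt0 ?expR_gt0//; lra.
  have : (expR (- (l * g.[x])) <= expR 2^-1)%R.
    rewrite ler_expR; apply: le_trans lD; rewrite -mulrN.
    by rewrite ler_wpM2l ?(ltW l0)// lerNl.
  by rewrite /z; lra.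
pose q n : {poly R} := (1%:P - (1%:P - 'X^n) ^+ (2 ^ n))%R.
have qE n w : (q n).[w] = (1 - (1 - w ^+ n) ^+ (2 ^ n))%R.
  by rewrite /q hornerD hornerN horner_exp hornerD hornerN hornerC hornerXn.
have q01 n x : (0 <= (q n).[z x] <= 1)%R.
  have zn : (0 <= z x ^+ n <= 1)%R by rewrite exprn_ge0//= exprn_ile1.
  have : (0 <= (1 - z x ^+ n) ^+ (2 ^ n) <= 1)%R.
    by rewrite exprn_ge0 ?exprn_ile1//; lra.
  by rewrite qE; lra.
have mz : measurable_fun setT z.
  apply: measurable_funM => //; apply: measurableT_comp => //.
  by apply: measurableT_comp => //; exact: measurable_funM.
have mq n : measurable_fun setT (fun x => (q n).[z x]).
  exact: (measurableT_comp (measurable_horner (q n)) mz).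
pose f_ n (x : measurableTypeR R) := (F x * (q n).[z x])%:E.
pose f (x : measurableTypeR R) := (F x * \1_(`]a, b[%classic) x)%:E.
have ae_itv : {ae mu, forall x : measurableTypeR R, x != a /\ x != b}.
  exists ([set a] `|` [set b])%classic; split.
  - exact: measurableU.
  - by rewrite null_set_setU// atomless.
  - by move=> x /= /not_andP[] /negP; rewrite negbK => /eqP ->; [left|right].
have [|||||_ _] := @dominated_convergence _ _ _ mu setT measurableT f_ f
    (fun x => `|(F x)%:E|).
- by move=> n; apply/measurable_EFinP; apply: measurable_funM.
- by apply/measurable_EFinP; apply: measurable_funM.
- apply: filterS ae_itv => x [xa xb] _; apply: cvg_EFin; first exact: nearW.
  apply: cvgMr; under eq_fun do rewrite qE.
  rewrite indicE; case: (boolP (x \in `]a, b[%classic)).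
    rewrite inE/= in_itv/= => /andP[ax xb'].
    apply: cvg_threshold_gt; rewrite z1 andbT /z -[ltLHS]mulr1 ltr_pM2l//.
    by rewrite -[ltLHS]expR0 ltr_expR gE oppr_gt0 pmulr_rlt0// pmulr_rlt0; lra.
  rewrite notin_setE/= in_itv/= => /negP; rewrite negb_and -!leNgt => xab.
  apply: cvg_threshold_lt; rewrite z0 /= /z -[ltRHS]mulr1 ltr_pM2l//.
  rewrite -[ltRHS]expR0 ltr_expR gE oppr_lt0 pmulr_rgt0//.
  case/orP: xab => [xa'|bx].
    have : (x < a)%R by rewrite lt_neqAle xa.
    by move=> ?; rewrite nmulr_rgt0; lra.
  have : (b < x)%R by rewrite lt_neqAle eq_sym xb.
  by move=> ?; rewrite pmulr_rgt0; lra.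
- exact: integrable_abse.
- apply: nearW => x n _; rewrite lee_fin normrM ler_piMr//.
  by have /andP[? ?] := q01 n x; rewrite ger0_norm.
rewrite (_ : [sequence _]_n = cst 0); last first.
  by apply/funext => n; exact: (orth_horner_exp (ltW l0) lc g_ge g_le (q n)).
move=> /(cvg_lim (@ereal_hausdorff _)); rewrite lim_cst// => /esym f0.
rewrite integral_mkcond -[RHS]f0; apply: eq_integral => x _.
by rewrite epatch_indic.
Qed.

(** The sets over which [F] integrates to 0 form a Dynkin system, the whole line being one because 1
    is a polynomial. The half-open intervals generate the sigma-algebra and differ from open ones by
    a null point. *)
Lemma orth_measurable (A : set (measurableTypeR R)) : measurable A ->
  \int[mu]_(x in A) (F x)%:E = 0.
Proof.
have FT : \int[mu]_x (F x)%:E = 0.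
  by rewrite -(F_orth 1%:P); apply: eq_integral => x _; rewrite hornerC mulr1.
have iFS (B : set (measurableTypeR R)) : measurable B -> mu.-integrable B (fun x => (F x)%:E).
  by move=> mB; apply: integrableS iF.
move: A; apply: (@dynkin_induction _ (measurableTypeR R) (@ocitv R)
  (fun A => \int[mu]_(x in A) (F x)%:E = 0)) => //.
- exact: ocitvI.
- move=> _ [[a b] _ <-] /=; case: (ltP a b) => ab; last first.
    by rewrite set_itv_ge ?integral_set0// bnd_simp -leNgt.
  rewrite -(@setUitv1 _ _ (BRight a) b true) ?bnd_simp// integral_setU//.
  - rewrite orth_itv// add0e null_set_integral ?atomless//.
    exact/measurable_EFinP/measurable_funTS.
  - exact/measurable_EFinP/measurable_funTS.
  - apply/disj_setPS => x [/=]; rewrite in_itv/= => /andP[_ xb] xb'.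
    by rewrite xb' ltxx in xb.
- move=> B mB B0; move: FT; rewrite -(setvU B) integral_setU//.
  - by rewrite B0 adde0.
  - exact: measurableC.
  - exact/measurable_EFinP/measurable_funTS.
  - by apply/disj_setPS => x [].
- move=> G mG tG G0; rewrite integral_bigcup//; last first.
    by apply: iFS; exact: bigcup_measurable.
  by rewrite eseries0// => n _ _; exact: G0.
Qed.

Lemma polynomials_total : {ae mu, forall x, F x = 0%R}.
Proof.
have : ae_eq mu setT (fun x => (F x)%:E) (cst 0).
  apply: integral_ae_eq => // A _ mA.
  by rewrite orth_measurable// integral0.
by apply: filterS => x /(_ I) [].
Qed.

End PolynomialDensity.

(** * Hermite polynomials *)

Section HermitePolynomials.
Context (R : realType).

(** The coefficient of [x^(n - 2j)] in the physicists' Hermite polynomial divided by [2^n]. The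
    falling factorial vanishes once [2j > n], so the sum in [monic_hermite] may run up to [n] and
    truncated exponents carry the coefficient 0. *)
Definition hermite_coef (n j : nat) : R :=
  (- 4^-1) ^+ j * (n ^_ j.*2)%:R / j`!%:R.

Definition monic_hermite (n : nat) : {poly R} :=
  \sum_(j < n.+1) hermite_coef n j *: 'X^(n - j.*2).

Definition hermite_norm (n : nat) : R := Num.sqrt 2 ^+ n / Num.sqrt n`!%:R.

(** Subtraction in [R] makes this true also for [n < m], where both sides vanish. *)
Lemma natr_ffactSr n m : (n ^_ m.+1)%:R = (n ^_ m)%:R * (n%:R - m%:R) :> R.
Proof.
rewrite ffactnSr natrM; case: (leqP m n) => mn; first by rewrite natrB.
by rewrite ffact_small// !mul0r.
Qed.

Lemma hermite_coef_gt n j : (n < j.*2)%N -> hermite_coef n j = 0.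
Proof. by move=> nj; rewrite /hermite_coef ffact_small// mulr0 mul0r. Qed.

Lemma natr_fact_neq0 n : n`!%:R != 0 :> R.
Proof. by rewrite pnatr_eq0 -lt0n fact_gt0. Qed.

(** The [j]-th factors of the two Pochhammer symbols multiply to [(n - 2j) (n - 2j - 1) / 4], which
    adds two factors to the falling factorial. *)
Lemma hyp2F0_hermite_coef n j :
  hyp2F0_coef (- (n%:R / 2)) (- ((n%:R - 1) / 2)) j * (-1) ^+ j =
  hermite_coef n j.
Proof.
rewrite /hyp2F0_coef /hermite_coef.
suff -> : pochhammer (- (n%:R / 2)) j * pochhammer (- ((n%:R - 1) / 2)) j =
    4^-1 ^+ j * (n ^_ j.*2)%:R :> R.
  by rewrite [(- 4^-1) ^+ j]exprNn; ring.
elim: j => [|j IH]; first by rewrite /pochhammer !big_ord0 expr0 double0 ffactn0.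
have pochS a : pochhammer a j.+1 = pochhammer a j * (a + j%:R) :> R.
  by rewrite /pochhammer big_ord_recr.
rewrite !pochS mulrACA IH doubleS !natr_ffactSr exprS -[j.*2.+1%:R]natr1.
by rewrite -mul2n natrM; field.
Qed.

Lemma hermiteE n : hermite R n = hermite_norm n *: monic_hermite n.
Proof.
rewrite /hermite /monic_hermite /hermite_norm; congr (_ *: _).
under eq_bigr do rewrite hyp2F0_hermite_coef.
rewrite -!(big_mkord xpredT (fun j => hermite_coef n j *: 'X^(n - j.*2))).
rewrite [RHS](big_cat_nat _ (n := n./2.+1))//=; last first.
  by rewrite ltnS -{2}(odd_double_half n) -addnn addnA leq_addl.
rewrite [X in _ + X]big_nat [X in _ + X]big1 ?addr0// => j /andP[nj _].
by rewrite hermite_coef_gt ?scale0r// ltnNge -geq_half_double -ltnNge.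
Qed.

Lemma monic_hermite0 : monic_hermite 0 = 1.
Proof.
by rewrite /monic_hermite big_ord1 /hermite_coef expr0 ffactn0 fact0 divr1 mulr1 scale1r.
Qed.

Lemma monic_hermite1 : monic_hermite 1 = 'X.
Proof.
rewrite /monic_hermite !big_ord_recl big_ord0 [hermite_coef 1 (lift _ _)]hermite_coef_gt//.
by rewrite scale0r !addr0 /hermite_coef expr0 ffactn0 fact0 divr1 mulr1 scale1r.
Qed.

Lemma hermite_coefSS n j : hermite_coef n.+2 j.+1 =
  hermite_coef n.+1 j.+1 - n.+1%:R / 2 * hermite_coef n j.
Proof.
rewrite /hermite_coef doubleS ffactSS [(n.+1 ^_ j.*2.+2)%:R]natr_ffactSr.
rewrite natrM ffactSS natrM exprS factS natrM -[j.*2.+1%:R]natr1 -mul2n natrM.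
rewrite -[n.+2%:R]natr1 -[n.+1%:R]natr1 -[j.+1%:R]natr1.
have j1 : j%:R + 1 != 0 :> R by rewrite natr1 pnatr_eq0.
by have jf := natr_fact_neq0 j; field; rewrite jf j1.
Qed.

Lemma monic_hermiteSS n : monic_hermite n.+2 =
  'X * monic_hermite n.+1 - (n.+1%:R / 2) *: monic_hermite n.
Proof.
rewrite /monic_hermite big_ord_recl big_ord_recr/=.
rewrite [X in _ + (_ + X)](_ : _ = 0) ?addr0; last first.
  by rewrite hermite_coef_gt ?scale0r// /bump /= -addnn; lia.
rewrite mulr_sumr [in RHS]big_ord_recl scaler_sumr -addrA -sumrB; congr (_ + _).
  by rewrite /hermite_coef !subn0 !expr0 !ffactn0 -scalerAr -exprS.
apply: eq_bigr => j _; rewrite /bump/= add1n hermite_coefSS scalerBl scalerA.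
congr (_ - _); rewrite -scalerAr doubleS !subSS.
(* In the first case the subtraction in the exponent truncates, but the coefficient is 0. *)
case: (ltnP n.+1 j.*2.+2) => nj; first by rewrite hermite_coef_gt ?scale0r.
by rewrite -exprS -subSn//; lia.
Qed.

Lemma deriv_monic_hermite n :
  (monic_hermite n.+1)^`() = n.+1%:R *: monic_hermite n.
Proof.
rewrite /monic_hermite big_ord_recr/= hermite_coef_gt ?scale0r ?addr0; last first.
  by rewrite -addnn; lia.
rewrite raddf_sum scaler_sumr; apply: eq_bigr => j _.
rewrite [LHS]derivZ derivXn scalerA.
have -> : (n.+1 - j.*2).-1 = (n - j.*2)%N by lia.
rewrite -scaler_nat scalerA; congr (_ *: _).
rewrite /hermite_coef; case: (leqP j.*2 n.+1) => nj; last first.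
  rewrite !ffact_small//; last by lia.
  by rewrite !(mulr0, mul0r).
rewrite natrB//.
have := natr_ffactSr n.+1 j.*2; rewrite ffactSS natrM => e.
rewrite [LHS]mulrAC -[X in X / _ = _]mulrA -e; ring.
Qed.

Lemma hermite_normS n :
  hermite_norm n.+1 * Num.sqrt n.+1%:R = Num.sqrt 2 * hermite_norm n.
Proof.
rewrite /hermite_norm factS natrM sqrtrM// exprS.
have : Num.sqrt n.+1%:R != 0 :> R by rewrite gt_eqF// sqrtr_gt0.
have : Num.sqrt n`!%:R != 0 :> R by rewrite gt_eqF// sqrtr_gt0 ltr0n fact_gt0.
by move=> h1 h2; field; rewrite h1 h2.
Qed.

Lemma hermite0 : hermite R 0 = 1.
Proof.
by rewrite hermiteE monic_hermite0 /hermite_norm expr0 fact0 sqrtr1 divr1 scale1r.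
Qed.

Lemma sqrt2_neq0 : Num.sqrt 2 != 0 :> R.
Proof. by rewrite gt_eqF// sqrtr_gt0. Qed.

Lemma sqrtS_neq0 n : Num.sqrt n.+1%:R != 0 :> R.
Proof. by rewrite gt_eqF// sqrtr_gt0. Qed.

(* At [n = 0] the last term is [0 *: hermite R 0]. *)
Lemma hermite_recurrence n : Num.sqrt 2 *: ('X * hermite R n) =
  Num.sqrt n.+1%:R *: hermite R n.+1 + Num.sqrt n%:R *: hermite R n.-1.
Proof.
have s0 := sqrtS_neq0; have s2 := sqrt2_neq0.
rewrite !hermiteE -!scalerAr !scalerA -hermite_normS [Num.sqrt n.+1%:R * _]mulrC.
case: n => [|n].
  by rewrite sqrtr0 mul0r scale0r addr0 monic_hermite0 monic_hermite1 mulr1.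
have -> : 'X * monic_hermite n.+1 =
    monic_hermite n.+2 + (n.+1%:R / 2) *: monic_hermite n.
  by rewrite monic_hermiteSS subrK.
rewrite scalerDr scalerA; congr (_ + _ *: _).
apply: (mulIf (s0 n)); rewrite hermite_normS /=.
have h1 : Num.sqrt n.+1%:R * Num.sqrt n.+1%:R = n.+1%:R :> R by rewrite -expr2 sqr_sqrtr.
have h2 : Num.sqrt 2 * Num.sqrt 2 = 2 :> R by rewrite -expr2 sqr_sqrtr.
transitivity (Num.sqrt 2 * (hermite_norm n.+1 * Num.sqrt n.+1%:R) * (n.+1%:R / 2)).
  by ring.
rewrite hermite_normS mulrA h2.
transitivity (Num.sqrt n.+1%:R * Num.sqrt n.+1%:R * hermite_norm n); last by ring.
by rewrite h1; field.
Qed.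

Lemma deriv_hermite n :
  (hermite R n)^`() = (Num.sqrt 2 * Num.sqrt n%:R) *: hermite R n.-1.
Proof.
case: n => [|n].
  by rewrite hermite0 -polyC1 derivC sqrtr0 mulr0 scale0r.
rewrite !hermiteE derivZ deriv_monic_hermite !scalerA; congr (_ *: _).
have h1 : Num.sqrt n.+1%:R * Num.sqrt n.+1%:R = n.+1%:R :> R by rewrite -expr2 sqr_sqrtr.
by rewrite -[in LHS]h1 mulrA hermite_normS /= mulrAC.
Qed.

(** Eliminates [hermite R n.-1] between the three-term recurrence and the derivative formula; in
    this shape integration by parts applies. *)
Lemma hermiteS n : Num.sqrt n.+1%:R *: hermite R n.+1 =
  Num.sqrt 2 *: ('X * hermite R n) - (Num.sqrt 2)^-1 *: (hermite R n)^`().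
Proof.
by rewrite hermite_recurrence deriv_hermite [X in _ - X]scalerA (mulKf sqrt2_neq0) addrK.
Qed.

End HermitePolynomials.

(** * Gaussian measures *)

Section WeightedIntegral.
Local Open Scope ereal_scope.
Context d (T : measurableType d) (R : realType) (mu : {measure set T -> \bar R}).
Context (w : T -> R) (mw : measurable_fun setT w) (w_ge0 : forall x, (0 <= w x)%R).

Lemma weightedE A : weighted mu w A = \int[mu]_(x in A) (w x)%:E.
Proof. by rewrite /weighted asboolT. Qed.

Import HBNNSimple.

Let integral_weighted_nnsfun (g : {nnsfun T >-> R}) :
  \int[weighted mu w]_x (g x)%:E = \int[mu]_x ((g x)%:E * (w x)%:E).
Proof.
have mwE : measurable_fun setT (fun x => (w x)%:E) by exact/measurable_EFinP.
transitivity (\int[weighted mu w]_x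
   (\sum_(y \in range g) (y * \1_(g @^-1` [set y]) x)%:E)).
  by apply: eq_integral => x _; rewrite fimfunE -fsumEFin.
have mi r : measurable_fun setT (fun x => (r * \1_(g @^-1` [set r]) x)%:E).
  by apply/measurable_EFinP; exact: measurable_funM.
rewrite ge0_integral_fsum//; last by move=> n x _; exact: nnfun_muleindic_ge0.
transitivity (\int[mu]_x (\sum_(y \in range g)
    (y * \1_(g @^-1` [set y]) x)%:E * (w x)%:E)); last first.
  apply: eq_integral => x _.
  rewrite -ge0_mule_fsuml => [|y]; last exact: nnfun_muleindic_ge0.
  by rewrite fsumEFin// -(fimfunE _ x).
rewrite ge0_integral_fsum//; last 2 first.
  - by move=> r; apply: emeasurable_funM.
  - move=> r x _; apply: mule_ge0; last by rewrite lee_fin.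
    exact: nnfun_muleindic_ge0.
apply: eq_fsbigr => r rg.
under [LHS]eq_integral do rewrite EFinM.
rewrite integralZl_indic_nnsfun//.
under [RHS]eq_integral do rewrite EFinM -muleA.
have r0 : (0 <= r)%R by move: rg; rewrite inE => -[x _ <-].
rewrite ge0_integralZl//; last 2 first.
  - by apply: emeasurable_funM => //; exact/measurable_EFinP.
  - by move=> x _; rewrite mule_ge0 ?lee_fin.
congr *%E; rewrite integral_indic// setIT.
transitivity (weighted mu w (g @^-1` [set r])) => //.
rewrite weightedE integral_mkcond; apply: eq_integral => x _.
by rewrite epatch_indic /= muleC.
Qed.

(** Both sides are limits along the same simple approximations of [f], by monotone convergence for
    each of the two measures. *)
Lemma ge0_integral_weighted (f : T -> \bar R) :
  measurable_fun setT f -> (forall x, 0 <= f x) ->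
  \int[weighted mu w]_x f x = \int[mu]_x (f x * (w x)%:E).
Proof.
move=> mf f0; pose h := nnsfun_approx measurableT mf.
have mwE : measurable_fun setT (fun x => (w x)%:E) by exact/measurable_EFinP.
have hf x : EFin \o h ^~ x @ \oo --> f x.
  by apply: cvg_nnsfun_approx.
have -> : \int[weighted mu w]_x f x =
    limn (fun n => \int[weighted mu w]_x (h n x)%:E).
  rewrite -monotone_convergence//.
  - by apply: eq_integral => x _; apply/esym/cvg_lim => //; exact: hf.
  - by move=> n; exact/measurable_EFinP.
  - by move=> n x _; rewrite lee_fin.
  - by move=> x _ a b ab; rewrite lee_fin; exact/lefP/nd_nnsfun_approx.
have -> : \int[mu]_x (f x * (w x)%:E) =
    limn (fun n => \int[mu]_x ((h n x)%:E * (w x)%:E)).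
  rewrite -monotone_convergence//.
  - apply: eq_integral => x _; apply/esym/cvg_lim => //.
    by apply: cvgeZr => //; exact: hf.
  - by move=> n; apply: emeasurable_funM => //; exact/measurable_EFinP.
  - by move=> n x _; rewrite mule_ge0 ?lee_fin.
  - move=> x _ a b ab; rewrite lee_wpmul2r ?lee_fin//.
    exact/lefP/nd_nnsfun_approx.
by congr (limn _); apply/funext => n; exact: integral_weighted_nnsfun.
Qed.

Lemma integral_weighted (f : T -> \bar R) : measurable_fun setT f ->
  \int[weighted mu w]_x f x = \int[mu]_x (f x * (w x)%:E).
Proof.
move=> mf; rewrite [LHS]integralE [RHS]integralE.
rewrite !ge0_integral_weighted//; last 2 first.
- exact: measurable_funeneg.
- exact: measurable_funepos.
congr (_ - _); apply: eq_integral => x _.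
- by rewrite !funeposE [LHS]muleC maxe_pMr ?lee_fin// mule0 [X in maxe X _]muleC.
- by rewrite !funenegE [LHS]muleC maxe_pMr ?lee_fin// mule0 muleN [in RHS]muleC.
Qed.

End WeightedIntegral.

(** * Integrals of derivatives over the line *)

Section DerivativeOnTheLine.
Local Open Scope ereal_scope.
Context (R : realType).
Local Notation leb := (@lebesgue_measure R).

Lemma integral_derivative0 (G g : R -> R) :
  (forall x : R, is_derive x (1 : R)%R G (g x)) -> continuous g ->
  leb.-integrable setT (fun x => (g x)%:E) ->
  (G n.+1%:R @[n --> \oo] --> (0 : R))%R ->
  (G (- n.+1%:R) @[n --> \oo] --> (0 : R))%R ->
  \int[leb]_x (g x)%:E = 0.
Proof.
move=> dG cg ig Gy GNy.
have mg : measurable_fun setT (fun x : measurableTypeR R => (g x)%:E).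
  by have /integrableP[] := ig.
(* The bound [n.+1] keeps every interval nondegenerate, as the fundamental theorem of calculus
   requires. *)
pose I n : set (measurableTypeR R) := (`[(- n.+1%:R)%R, n.+1%:R]%classic).
pose f_ n (x : measurableTypeR R) := (g x * \1_(I n) x)%:E.
have f_E n : \int[leb]_x f_ n x = (G n.+1%:R - G (- n.+1%:R))%:E.
  have cG x : {for x, continuous G}.
    by apply: differentiable_continuous; apply/derivable1_diffP; case: (dG x).
  rewrite EFinB -(@continuous_FTC2 R g G).
  - rewrite [RHS]integral_mkcond; apply: eq_integral => x _; rewrite epatch_indic.
    by rewrite /f_ EFinM.
  - by rewrite (@lt_trans _ _ 0%R)// oppr_lt0.
  - exact: continuous_subspaceT.
  - split.
    + by move=> x _; case: (dG x).
    + by apply: cvg_at_right_filter; exact: cG.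
    + by apply: cvg_at_left_filter; exact: cG.
  - by move=> x _; rewrite derive1E; case: (dG x).
have [|||||_ _] := @dominated_convergence _ _ _ leb setT measurableT f_
    (fun x => (g x)%:E) (fun x => `|(g x)%:E|) => //.
- move=> n; rewrite /f_; under eq_fun do rewrite EFinM; apply: emeasurable_funM => //.
  by apply/measurable_EFinP; apply: measurable_indic; exact: measurable_itv.
- apply: nearW => x _; apply: cvg_near_cst.
  have [N xN] : exists N : nat, (`|x| <= N%:R)%R.
    by exists (Num.bound `|x|)%R; apply/ltW/archi_boundP.
  exists N => // n /= Nn; rewrite /f_ indicE mem_set ?mulr1//.
  rewrite /I/= in_itv/= -ler_norml (le_trans xN)// ler_nat; exact: leqW.
- exact: integrable_abse.
- apply: nearW => x n _; rewrite lee_fin normrM ler_piMr//.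
  by rewrite indicE; case: (_ \in _); rewrite ?normr1 ?normr0.
rewrite (_ : [sequence _]_n = (fun n => (G n.+1%:R - G (- n.+1%:R))%:E)); last first.
  by apply/funext => n; exact: f_E.
have : (G n.+1%:R - G (- n.+1%:R))%:E @[n --> \oo] --> 0.
  apply: cvg_EFin; first exact: nearW.
  by rewrite -[X in _ --> X](subrr (0 : R)%R); exact: cvgB.
by move=> h1 h2; apply/esym; exact: (cvg_unique _ h1 h2).
Qed.

End DerivativeOnTheLine.

(** * Gaussian moments and integration by parts *)

Section GaussianMeasure.
Context (R : realType) (h r s : R).
Context (h_gt0 : 0 < h) (r_gt0 : 0 < r).
Local Notation leb := (@lebesgue_measure R).
Local Notation w := (gauss_weight h r s).
Local Notation mu := (gauss_measure h r s).

Let m := - (h * s).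
Let sigma := r * Num.sqrt h.
(** A quarter of the Gaussian exponent: the weight decays like [exp (- 4 c (x - m)^2)]. Half of this
    pays for recentring at 0, one quarter is available for growth, and the last quarter keeps the
    product integrable. *)
Let c := (8 * h * r ^+ 2)^-1.

Let sigma_gt0 : 0 < sigma. Proof. by rewrite mulr_gt0// sqrtr_gt0. Qed.

Let sigma2 : sigma ^+ 2 = h * r ^+ 2.
Proof. by rewrite exprMn sqr_sqrtr ?ltW// mulrC. Qed.

Let c_gt0 : 0 < c. Proof. by rewrite invr_gt0 !mulr_gt0// exprn_gt0. Qed.

Lemma gauss_weightE x : w x = normal_pdf m sigma x.
Proof.
rewrite normal_pdfE ?gt_eqF// /gauss_weight /normal_peak /normal_fun.
congr (_^-1 * expR _).
  rewrite -[r]gtr0_norm// -sqrtr_sqr -sqrtrM ?sqr_ge0// sigma2; congr Num.sqrt.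
  by rewrite -mulr_natr; ring.
rewrite sigma2 /m opprK mulNr -mulr_natr; congr (- (_ / _)); ring.
Qed.

Lemma integral_gauss_weight : (\int[leb]_x (w x)%:E = 1)%E.
Proof.
by under eq_integral do rewrite gauss_weightE; exact: integral_normal_pdf.
Qed.

Let w_ge0 x : 0 <= w x. Proof. by rewrite gauss_weight_ge0// ltW. Qed.

Let mw : measurable_fun setT w. Proof. exact: measurable_gauss_weight. Qed.

Lemma gauss_measure_setT : mu setT = 1%E.
Proof. by rewrite weightedE// integral_gauss_weight. Qed.

Lemma gauss_measure_set1 x : mu [set x] = 0%E.
Proof. by rewrite weightedE// integral_set1. Qed.

(** Completing the square: [4 (x - m)^2 = 2 x^2 - 4 m^2 + 2 (x - 2 m)^2]. *)
Lemma gauss_weight_decay : exists2 K, 0 <= K &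
  forall x, w x <= K * expR (- (2 * c * x ^+ 2)).
Proof.
exists ((r * Num.sqrt (2 * h * pi))^-1 * expR (4 * c * m ^+ 2)).
  by rewrite mulr_ge0 ?expR_ge0// invr_ge0 mulr_ge0// ltW.
move=> x; rewrite /gauss_weight -[leRHS]mulrA -expRD ler_wpM2l//.
  by rewrite invr_ge0 mulr_ge0// ltW.
rewrite ler_expR lerNl opprB.
have -> : (x + h * s) ^+ 2 / (2 * h * r ^+ 2) = 4 * c * (x - m) ^+ 2.
  by rewrite /c /m; field; rewrite !gt_eqF.
have : 0 <= c * (x - 2 * m) ^+ 2 by rewrite mulr_ge0 ?sqr_ge0// ltW.
nra.
Qed.

(** Since [c = 1 / (2 (2 sigma)^2)], this is a multiple of the centred normal density of standard
    deviation [2 sigma]. *)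
Lemma integrable_exp_neg_sqr : leb.-integrable setT (fun x => (expR (- (c * x ^+ 2)))%:E).
Proof.
have s0 : 2 * sigma != 0 by rewrite gt_eqF// mulr_gt0.
have := integrableZl measurableT (normal_peak (2 * sigma))^-1
  (integrable_normal_pdf 0 (2 * sigma)).
apply: eq_integrable => // x _; rewrite normal_pdfE// -EFinM mulrA mulVf ?mul1r.
  rewrite /normal_fun; congr (expR _)%:E.
  by rewrite subr0 exprMn sigma2 /c -mulr_natr; field; rewrite !gt_eqF.
by rewrite gt_eqF// normal_peak_gt0.
Qed.

Lemma integrable_mul_gauss (u : measurableTypeR R -> R) C : measurable_fun setT u ->
  (forall x, `|u x| <= C * expR (c * x ^+ 2)) ->
  leb.-integrable setT (fun x => (u x * w x)%:E).
Proof.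
move=> mu_ uC; have [K K0 wK] := gauss_weight_decay.
have := integrableZl measurableT (C * K) integrable_exp_neg_sqr.
apply: le_integrable => //.
  by apply/measurable_EFinP; exact: measurable_funM.
move=> x _; rewrite -EFinM !abse_EFin lee_fin.
apply: le_trans (ler_norm _); rewrite normrM (ger0_norm (w_ge0 x)).
have -> : C * K * expR (- (c * x ^+ 2)) =
    C * expR (c * x ^+ 2) * (K * expR (- (2 * c * x ^+ 2))).
  rewrite [RHS]mulrACA -expRD; congr (_ * expR _); ring.
exact: ler_pM.
Qed.

Lemma gauss_exp_moment : (\int[mu]_x (expR (c * x ^+ 2))%:E < +oo)%E.
Proof.
have mE : measurable_fun setT (fun x : measurableTypeR R => expR (c * x ^+ 2)).
  by apply: measurableT_comp => //; apply: measurable_funM => //; exact: measurable_funX.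
rewrite integral_weighted//; last exact/measurable_EFinP.
under eq_integral do rewrite -EFinM.
have iE := @integrable_mul_gauss _ 1 mE.
apply: (@integral_fune_lt_pinfty _ _ _ leb setT) => //; apply: iE => x.
by rewrite mul1r ger0_norm// expR_ge0.
Qed.

Lemma integrable_poly_gauss (P : {poly R}) : mu.-integrable setT (fun x => (P.[x])%:E).
Proof.
have mP : measurable_fun setT (fun x : measurableTypeR R => P.[x]) by exact: measurable_poly.
apply/integrableP; split; first exact/measurable_EFinP.
have [C C0 PC] := poly_le_exp_sqr P c_gt0.
rewrite integral_weighted//; last by apply/measurable_EFinP; exact: measurableT_comp.
have iP := @integrable_mul_gauss (fun x => `|P.[x]|) C.
apply: (@integral_fune_lt_pinfty _ _ _ leb setT) => //.
by apply: iP => [|x]; [exact: measurableT_comp|rewrite normr_id].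
Qed.

(** Stein's identity for mean [- h s] and variance [h r^2]: the derivative of [P * w] is [Q * w],
    and its integral over the line is 0. *)
Lemma gauss_integration_by_parts (P : {poly R}) :
  \int[mu]_x ((('X + (h * s)%:P) * P).[x]) = h * r ^+ 2 * \int[mu]_x (P^`().[x]).
Proof.
pose e : {poly R} := - (2 * h * r ^+ 2)^-1 *: ('X + (h * s)%:P) ^+ 2.
have wE x : w x = (r * Num.sqrt (2 * h * pi))^-1 * expR e.[x].
  rewrite /gauss_weight /e hornerZ horner_exp hornerD hornerX hornerC.
  by rewrite mulNr [X in - X]mulrC.
pose Q : {poly R} := P^`() - (h * r ^+ 2)^-1 *: (('X + (h * s)%:P) * P).
pose k := (r * Num.sqrt (2 * h * pi))^-1.
have hr0 : h * r ^+ 2 != 0 by rewrite gt_eqF// mulr_gt0// exprn_gt0.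
have eE x : e^`().[x] = - (h * r ^+ 2)^-1 * (x + h * s).
  rewrite /e derivZ deriv_exp derivD derivX derivC addr0 mul1r expr1.
  rewrite hornerZ hornerMn hornerD hornerX hornerC -mulr_natr.
  by field; rewrite !gt_eqF.
have GE : (fun x => P.[x] * w x) = horner P * (k \*: (expR \o horner e)).
  by apply/funext => x; rewrite wE.
have dG (x : R) : is_derive x (1 : R) (fun x => P.[x] * w x) (Q.[x] * w x).
  have de := is_derive1_comp (is_derive_expR e.[x]) (is_derive_poly e x).
  have dPk := is_deriveM (is_derive_poly P x) (is_deriveZ k de).
  rewrite GE; apply: is_derive_eq dPk _.
  rewrite [LHS](_ : _ = P.[x] * (k * (expR e.[x] * e^`().[x])) +
    k * expR e.[x] * P^`().[x])//.
  rewrite eE wE -/k; move: (expR _) => E.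
  by rewrite /Q hornerD hornerN hornerZ hornerM hornerD hornerX hornerC; ring.
have cQ : continuous (fun x => Q.[x] * w x).
  have -> : (fun x => Q.[x] * w x) = horner Q * (k \*: (expR \o horner e)).
    by apply/funext => x; rewrite wE.
  move=> x; apply: cvgM; first exact: continuous_horner.
  apply: cvgZr; apply: continuous_comp; first exact: continuous_horner.
  exact: continuous_expR.
have mQ : measurable_fun setT (fun x : measurableTypeR R => Q.[x]) by exact: measurable_poly.
have iQ : leb.-integrable setT (fun x => (Q.[x] * w x)%:E).
  by have [C C0 QC] := poly_le_exp_sqr Q c_gt0; exact: (integrable_mul_gauss mQ QC).
have [C C0 PC] := poly_le_exp_sqr P c_gt0.
have [K K0 wK] := gauss_weight_decay.
(* Fixing only [x^2] covers both ends of the line. The decay comes from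
   [exp (- c x^2) <= 1 / (c x^2)] and [n.+1 <= n.+1 ^ 2]. *)
have Gbnd (x : R) n : x ^+ 2 = n.+1%:R ^+ 2 ->
    - (C * K / c * harmonic n) <= P.[x] * w x <= C * K / c * harmonic n.
  move=> xn; rewrite -ler_norml normrM [`|w x|]ger0_norm//.
  apply: (@le_trans _ _ (C * K * expR (- (c * x ^+ 2)))).
    have -> : C * K * expR (- (c * x ^+ 2)) =
      C * expR (c * x ^+ 2) * (K * expR (- (2 * c * x ^+ 2))).
      rewrite [RHS]mulrACA -expRD; congr (_ * expR _); ring.
    exact: ler_pM.
  rewrite -[leRHS]mulrA ler_wpM2l ?mulr_ge0// expRN /harmonic/= -invfM.
  rewrite lef_pV2 ?posrE ?expR_gt0 ?mulr_gt0//.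
  apply: le_trans (expR_ge1Dx _); rewrite xn.
  have n1 : (1 : R) <= n.+1%:R by rewrite ler1n.
  apply: (@le_trans _ _ (c * n.+1%:R ^+ 2)); last by rewrite lerDr.
  by rewrite ler_wpM2l ?(ltW c_gt0)// expr2 ler_peMr.
have H0 : C * K / c * harmonic n @[n --> \oo] --> (0 : R).
  by rewrite -[X in _ --> X](mulr0 (C * K / c)); apply: cvgMr; exact: cvg_harmonic.
have G0 (x : nat -> R) : (forall n, x n ^+ 2 = n.+1%:R ^+ 2) ->
    P.[x n] * w (x n) @[n --> \oo] --> (0 : R).
  move=> xn; apply: (@squeeze_cvgr _ _ _ _ (fun n => - (C * K / c * harmonic n))
    (fun n => C * K / c * harmonic n)) => //.
    by apply: nearW => n; exact: Gbnd.
  by rewrite -[X in _ --> X]oppr0; exact: cvgN.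
have Q0 : \int[mu]_x Q.[x] = 0.
  rewrite /Rintegral integral_weighted//; last exact/measurable_EFinP.
  under eq_integral do rewrite -EFinM.
  rewrite (integral_derivative0 dG cQ iQ)//; first exact: G0.
  by apply: G0 => n; rewrite sqrrN.
have iP' := integrable_poly_gauss P^`().
have iXP := integrable_poly_gauss (('X + (h * s)%:P) * P).
have : \int[mu]_x Q.[x] = \int[mu]_x P^`().[x] -
    (h * r ^+ 2)^-1 * \int[mu]_x (('X + (h * s)%:P) * P).[x].
  rewrite -RintegralZl// -RintegralB//; last first.
    by have := integrableZl measurableT (h * r ^+ 2)^-1 iXP.
  by apply: eq_Rintegral => x _; rewrite /Q hornerD hornerN hornerZ.
rewrite Q0 => /esym/eqP; rewrite subr_eq0 => /eqP ->.
by rewrite mulrA divff// mul1r.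
Qed.

End GaussianMeasure.

(** * The Hermite basis of the Gaussian L2 *)

(** Stated as an induction principle. The recurrence shows, by induction on [k], that [S] contains
    every ['X^k * hermite R n]; [n = 0] gives the monomials. *)
Lemma hermite_span (R : realType) (S : {poly R} -> Prop) : S 0 ->
  (forall a p q, S p -> S q -> S (a *: p + q)) ->
  (forall n, S (hermite R n)) -> forall p, S p.
Proof.
move=> S0 Slin SH.
have SZ a p : S p -> S (a *: p) by move=> Sp; rewrite -[_ *: _]addr0; exact: Slin.
have SX k n : S ('X^k * hermite R n).
  elim: k n => [|k IH] n; first by rewrite expr0 mul1r.
  move: (hermite_recurrence R n) (IH n.+1) (IH n.-1).
  move: (hermite R n) (hermite R n.+1) (hermite R n.-1) => A B C AE SB SC.
  have -> : 'X^(k.+1) * A = (Num.sqrt 2)^-1 *: ('X^k * (Num.sqrt 2 *: ('X * A))).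
    by rewrite -scalerAr scalerA mulVf ?sqrt2_neq0// scale1r mulrA -exprSr.
  apply: (SZ); rewrite AE mulrDr -!scalerAr.
  by apply: Slin => //; exact: SZ.
move=> p; rewrite -[p]coefK poly_def; elim/big_ind: _ => // [x y Sx Sy|i _].
  by rewrite -[x]scale1r; exact: Slin.
by apply: SZ; have := SX i 0%N; rewrite hermite0 mulr1.
Qed.

Section GaussHermite.
Context (R : realType) (h r s : R).
Context (h_gt0 : 0 < h) (r_gt0 : 0 < r).
Local Notation mu := (gauss_measure h r s).

Let a := (r * Num.sqrt (2 * h))^-1.
Let q : {poly R} := a *: ('X + (h * s)%:P).

Definition gauss_hermite n : {poly R} := hermite R n \Po q.

Lemma gauss_hermiteE n x :
  (gauss_hermite n).[x] = (hermite R n).[(x + h * s) / (r * Num.sqrt (2 * h))].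
Proof.
by rewrite horner_comp; congr (_.[_]); rewrite hornerZ hornerD hornerX hornerC mulrC.
Qed.

Let mean (P : {poly R}) : R := \int[mu]_x P.[x].

Let mean_lin b (P Q : {poly R}) : mean (b *: P + Q) = b * mean P + mean Q.
Proof.
have iP := integrable_poly_gauss s h_gt0 r_gt0 P.
have iQ := integrable_poly_gauss s h_gt0 r_gt0 Q.
rewrite /mean -RintegralZl// -RintegralD//; last first.
  by have := integrableZl measurableT b iP.
by apply: eq_Rintegral => x _; rewrite hornerD hornerZ.
Qed.

Let mean0 : mean 0 = 0.
Proof.
have := mean_lin 1 0 0; rewrite scale1r addr0 mul1r => /eqP.
by rewrite -subr_eq subrr => /eqP <-.
Qed.

Let meanZ b P : mean (b *: P) = b * mean P.
Proof. by rewrite -[_ *: _]addr0 mean_lin mean0 addr0. Qed.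

Let meanD P Q : mean (P + Q) = mean P + mean Q.
Proof. by rewrite -[P]scale1r mean_lin scale1r mul1r. Qed.

Let mean1 : mean 1 = 1.
Proof.
rewrite /mean /Rintegral; under eq_integral do rewrite hornerC.
by rewrite integral_cst// mul1e [X in fine X](gauss_measure_setT s h_gt0 r_gt0).
Qed.

(** In the variable [q] the measure has variance 1/2, that of the density proportional to
    [exp (- y^2)] for which the Hermite polynomials are orthonormal. *)
Let a2 : a * a * (h * r ^+ 2) = 2^-1.
Proof.
rewrite /a -invfM -expr2 exprMn sqr_sqrtr; last by rewrite mulr_ge0// ltW.
by field; rewrite !gt_eqF.
Qed.

Let mean_qM P : mean (q * P) = a * (h * r ^+ 2) * mean P^`().
Proof.
rewrite /q -scalerAl meanZ -mulrA; congr (_ * _).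
exact: gauss_integration_by_parts.
Qed.

Let deriv_comp_q p : (p \Po q)^`() = a *: (p^`() \Po q).
Proof.
rewrite deriv_comp /q derivZ derivD derivX derivC addr0.
by rewrite -scalerAr mulr1.
Qed.

(** Raising [n] is adjoint to lowering [m]. After [hermiteS] and integration by parts, the terms
    with the derivative of the [n]-th polynomial cancel, and only the derivative of the [m]-th one
    is left. *)
Let mean_rec n m : Num.sqrt n.+1%:R * mean (gauss_hermite n.+1 * gauss_hermite m) =
  Num.sqrt m%:R * mean (gauss_hermite n * gauss_hermite m.-1).
Proof.
have s2 := sqrt2_neq0 R.
pose Z k := (hermite R k)^`() \Po q.
have dZ k : (gauss_hermite k)^`() = a *: Z k by exact: deriv_comp_q.
have ZE k : Z k = (Num.sqrt 2 * Num.sqrt k%:R) *: gauss_hermite k.-1.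
  by rewrite /Z deriv_hermite comp_polyZ.
have hS : Num.sqrt n.+1%:R *: gauss_hermite n.+1 =
    Num.sqrt 2 *: (q * gauss_hermite n) - (Num.sqrt 2)^-1 *: Z n.
  rewrite /gauss_hermite /Z -comp_polyZ hermiteS; move: (hermite R n) => A.
  by rewrite comp_polyB !comp_polyZ comp_polyM comp_polyX.
rewrite -meanZ scalerAl hS; move: (dZ n) (dZ m) (ZE m).
move: (gauss_hermite n) (gauss_hermite m) (gauss_hermite m.-1) (Z n) (Z m).
move=> A B C ZA ZB dA dB ZBE.
have -> : (Num.sqrt 2 *: (q * A) - (Num.sqrt 2)^-1 *: ZA) * B =
    Num.sqrt 2 *: (q * (A * B)) + (- (Num.sqrt 2)^-1) *: (ZA * B).
  by rewrite mulrBl scaleNr mulrA !scalerAl.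
rewrite meanD !meanZ mean_qM derivM dA dB.
have -> : a *: ZA * B + A * (a *: ZB) = a *: (ZA * B + A * ZB).
  by rewrite scalerDr scalerAl scalerAr.
rewrite meanZ meanD.
rewrite [A * ZB](_ : _ = (Num.sqrt 2 * Num.sqrt m%:R) *: (A * C)) ?meanZ; last first.
  by rewrite ZBE scalerAr.
have s22 : Num.sqrt 2 * Num.sqrt 2 = 2 :> R by rewrite -expr2 sqr_sqrtr.
move: (mean (ZA * B)) (mean (A * C)) => X Y.
rewrite [X in _ * X]mulrA [a * _ * a]mulrAC a2.
have -> : (Num.sqrt 2)^-1 = Num.sqrt 2 / 2 :> R.
  by apply: (mulIf s2); rewrite mulVf// mulrAC s22 divff.
transitivity (Num.sqrt 2 * Num.sqrt 2 / 2 * (Num.sqrt m%:R * Y)); first by field.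
by rewrite s22 divff// mul1r.
Qed.

(** [mean_rec] lowers both indices until one is 0; its case [m = 0] gives orthogonality to the
    constants. *)
Lemma mean_gauss_hermite n m :
  \int[mu]_x (gauss_hermite n * gauss_hermite m).[x] = (n == m)%:R.
Proof.
have h0 k : mean (gauss_hermite k * gauss_hermite 0) = (k == 0%N)%:R.
  case: k => [|k].
    by rewrite /gauss_hermite hermite0 -(polyC1 R) comp_polyC polyC1 mulr1 mean1.
  apply: (mulfI (sqrtS_neq0 R k)).
  by rewrite mean_rec sqrtr0 mul0r mulr0.
rewrite -/(mean _); elim: n m => [|n IH] [|m]; rewrite ?h0//.
  by rewrite mulrC h0.
apply: (mulfI (sqrtS_neq0 R n)); rewrite mean_rec IH eqSS.
by case: eqVneq => [->|]; rewrite ?mulr0.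
Qed.

Let sq_integrable_poly (P : {poly R}) : sq_integrable mu (fun x => P.[x]%:C).
Proof.
split; first exact: measurable_poly.
  exact: measurable_cst.
under eq_integral do rewrite normc2C -horner_exp.
exact: integral_fune_lt_pinfty (integrable_poly_gauss s h_gt0 r_gt0 (P ^+ 2)).
Qed.

Lemma gauss_hermite_basis : exists P : nat -> L2 mu,
  [/\ forall n, represents (P n) (fun x => (gauss_hermite n).[x]%:C),
      orthonormal P & is_total P].
Proof.
have /choice[P PE] n := represents_ex (sq_integrable_poly (gauss_hermite n)).
exists P; split => // [n m|f fP].
  rewrite (L2_ipE _ _ (PE n) (PE m))//.
  rewrite (@eq_Rintegral _ _ _ mu setT
    (fun x => (gauss_hermite n * gauss_hermite m).[x])); last first.
    by move=> x _; rewrite hornerM /=; ring.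
  rewrite mean_gauss_hermite.
  rewrite (@eq_Rintegral _ _ _ mu setT (cst 0)); last by move=> x _ /=; ring.
  by rewrite Rintegral_cst// mul0r; case: eqP.
have [mfr mfi fsq] := L2_sq_integrable f.
have sq_lt (u : measurableTypeR R -> R) : measurable_fun setT u ->
   (forall x, u x ^+ 2 <= normc2 (f x)) ->
   (\int[mu]_x (u x ^+ 2)%:E < +oo)%E.
  move=> mu_ uf; apply: le_lt_trans fsq; apply: ge0_le_integral => //.
  - by move=> x _; rewrite lee_fin sqr_ge0.
  - by apply/measurable_EFinP; exact: measurable_funX.
  - exact: measurable_normc2.
  - by move=> x _; rewrite lee_fin.
(* The Hermite polynomials are real, so the real and imaginary parts of [f] are orthogonal to them
   separately, and each is a real function to which [polynomials_total] applies. *)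
have orth0 (u : measurableTypeR R -> R) : measurable_fun setT u ->
    (forall x, u x ^+ 2 <= normc2 (f x)) ->
    (forall n, \int[mu]_x (u x * (gauss_hermite n).[x]) = 0) ->
    {ae mu, forall x, u x = 0}.
  move=> mu_ uf un.
have usq : sq_integrable mu (fun x => (u x)%:C).
    split; [by []|exact: measurable_cst|].
    by under eq_integral do rewrite normc2C; exact: sq_lt.
  have iu (p : {poly R}) : mu.-integrable setT (EFin \o (fun x => u x * p.[x])).
    apply: (sq_integrable_mul usq (sq_integrable_poly p)).
      by apply: measurable_funM => //; exact: measurable_poly.
    move=> x; rewrite !normc2C ler_norml.
    have := sqr_ge0 (u x - p.[x]); have := sqr_ge0 (u x + p.[x]).
    have := sqr_ge0 (u x); have := sqr_ge0 p.[x].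
    by move=> *; apply/andP; split; nra.
  have orthq p : \int[mu]_x (u x * (p \Po q).[x]) = 0.
    elim/hermite_span: p => [|b p p' p0 p'0|n]; last exact: un.
      rewrite (@eq_Rintegral _ _ _ mu setT (cst 0)); first by rewrite Rintegral_cst// mul0r.
      by move=> x _; rewrite comp_poly0 horner0 mulr0.
    rewrite (@eq_Rintegral _ _ _ mu setT
      (fun x => b * (u x * (p \Po q).[x]) + u x * (p' \Po q).[x])); last first.
      by move=> x _; rewrite comp_polyD comp_polyZ hornerD hornerZ; ring.
    rewrite RintegralD//; last by have := integrableZl measurableT b (iu (p \Po q)).
    by rewrite RintegralZl ?p0 ?p'0 ?mulr0 ?addr0//; exact: iu.
  have a0 : a != 0 by rewrite gt_eqF// invr_gt0 mulr_gt0// sqrtr_gt0 mulr_gt0.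
  apply: (@polynomials_total R mu (8 * h * r ^+ 2)^-1 u) => //.
  - by rewrite invr_gt0 !mulr_gt0// exprn_gt0.
  - exact: gauss_exp_moment.
  - exact: sq_lt.
  (* Inverting the affine map [q] writes every polynomial in [x] as a polynomial in [q]. *)
  - move=> p; have -> : p = (p \Po (a^-1 *: 'X - (h * s)%:P)) \Po q.
      rewrite -comp_polyA comp_polyB comp_polyZ comp_polyX comp_polyC.
      by rewrite /q scalerA mulVf// scale1r addrK comp_polyXr.
    by rewrite -[LHS]fineK ?integrable_fin_num//; [congr EFin; exact: orthq|exact: iu].
  - exact: gauss_measure_set1.
have ipE n := L2_ipE (L2_sq_integrable f) (sq_integrable_poly (gauss_hermite n))
  (represents_self f) (PE n).
have f1 : {ae mu, forall x, Re (f x) = 0}.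
  apply: orth0 => //.
    by move=> x; rewrite normc2E lerDl sqr_ge0.
  move=> n; have := ipE n; rewrite fP => -[+ _] => /esym; apply: etrans.
  by apply: eq_Rintegral => x _; rewrite Re_mulC_conj /= mulr0 addr0.
have f2 : {ae mu, forall x, Im (f x) = 0}.
  apply: orth0 => //.
    by move=> x; rewrite normc2E lerDr sqr_ge0.
  move=> n; have := ipE n; rewrite fP => -[_ +] => /esym; apply: etrans.
  by apply: eq_Rintegral => x _; rewrite Im_mulC_conj /= mulr0 subr0.
apply: (represents_inj (represents_self f)).
apply: represents_ae (represents0 mu) _.
by apply: filterS2 f1 f2 => x; case: (f x) => p p' /= -> ->.
Qed.

End GaussHermite.

(** * The intertwining relation *)

Section ZeroDerivative.
Context (R : realType) (f : R -> R).
Context (f_deriv : forall t : R, 0 <= t -> has_deriv_within `[0, +oo[ f t 0).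

(** The difference quotient estimate cleared of its denominator, with [y = x] included; at [x = 0]
    it is one-sided. *)
Let increment_le (x e : R) : 0 <= x -> 0 < e -> exists2 d, 0 < d &
  forall y, 0 <= y -> `|y - x| < d -> `|f y - f x| <= e * `|y - x|.
Proof.
move=> x0 e0; have /cvgrPdist_le /(_ e e0) := f_deriv x0.
rewrite /dnbhs !near_withinE => -[d /= d0 dP]; exists d => // y y0 yx.
have [->|nyx] := eqVneq y x; first by rewrite !subrr normr0 mulr0.
have := dP y; rewrite /= distrC yx => /(_ isT nyx).
rewrite in_itv/= andbT y0 sub0r normrN normf_div => /(_ isT).
by rewrite ler_pdivrMr// normr_gt0 subr_eq0.
Qed.

Let is_derive_f (x : R) : 0 < x -> is_derive x (1 : R) f 0.
Proof.
move=> x0; have cv : h^-1 *: (f (h *: (1 : R) + x) - f x) @[h --> (0 : R)^'] --> (0 : R).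
  apply/cvgrPdist_le => e e0.
  have [d d0 dP] := increment_le (ltW x0) e0.
  (* Below the radius [x > 0] the point [h + x] stays in the half-line, so the derivative within it
     becomes a two-sided one. *)
  rewrite /dnbhs near_withinE; exists (Num.min d x); first by rewrite /= lt_min d0.
  move=> h /=; rewrite sub0r normrN lt_min => /andP[hd hx] h0.
  rewrite sub0r normrN normrM normfV mulrC ler_pdivrMr ?normr_gt0//.
  have := dP (h + x); rewrite addrK [h *: 1]mulr1; apply => //.
  by move: hx; rewrite ltr_norml => /andP[+ _]; rewrite -subr_gt0 opprK addrC => /ltW.
by split; [apply/cvg_ex; exists 0|exact/cvg_lim].
Qed.

(** The mean value theorem on [[0, t]] asks for derivatives in the interior and only for continuity
    from the right at 0, which [increment_le] supplies. *)
Lemma zero_derivative_const (t : R) : 0 < t -> f t = f 0.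
Proof.
move=> t0.
have cf (x : R) : 0 < x -> {for x, continuous f}.
  move=> x0; apply: differentiable_continuous; apply/derivable1_diffP.
  by case: (is_derive_f x0).
have [x _] : exists2 x, x \in `]0, t[%R & f t - f 0 = 0 * (t - 0).
  apply: (@MVT _ f (fun=> 0)) => // [x|].
    by rewrite in_itv/= => /andP[x0 _]; exact: is_derive_f.
  apply/continuous_within_itvP => //; split.
  - by move=> x; rewrite in_itv/= => /andP[x0 _]; exact: cf.
  - apply/cvgrPdist_le => e e0; have [d d0 dP] := increment_le (lexx 0) ltr01.
    exists (Num.min d e); first by rewrite /= lt_min d0.
    move=> y /=; rewrite sub0r normrN lt_min => /andP[yd ye] y0.
    have := dP y (ltW y0); rewrite subr0 mul1r distrC => /(_ yd) h.
    exact: le_trans h (ltW ye).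
  - by apply: cvg_at_left_filter; exact: cf.
by rewrite mul0r => /eqP; rewrite subr_eq0 => /eqP.
Qed.

End ZeroDerivative.

(** The coordinates of the vector vanish from [N] on, so the sum over all of [nat] in [osc_rep] has
    finite support and is not a default value. *)
Lemma osc_rep_finite (R : realType) (h k : R) (X : 'rV[R[i]]_4) N (c : nat -> R[i]) :
  osc_rep h k X (partial_sum (ell2_basis R) c N) =
  \sum_(n < N) c n *: osc_rep_basis h k X n.
Proof.
have vE n : partial_sum (ell2_basis R) c N n = if (n < N)%N then c n else 0.
  by rewrite -ip_ell2_basis (ip_partial_sum c N n (@ell2_basis_orthonormal R)).
rewrite /osc_rep (@fsbig_ord _ _ _ N (fun n => c n *: osc_rep_basis h k X n)).
rewrite -[LHS](@fsbig_widen _ _ _ _ `I_N)//; last first.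
  by move=> n [_ /= nN]; rewrite vE ifF ?scale0r//; apply/negP.
by apply: eq_fsbigr => n; rewrite inE/= => nN; rewrite vE nN.
Qed.

(** Uniqueness among bounded extensions belongs to the conclusion: [U] is the operator determined by
    its values on the basis. The identity with multiplication by [x] is between classes, hence
    almost everywhere, on the image of the finite combinations. *)
Theorem theorem5p3 (R : realType) (r s u : R -> R) (h k : R)
    (r_C1 : C1_on `[0, +oo[ r) (s_C1 : C1_on `[0, +oo[ s)
    (u_C0 : {within `[0, +oo[, continuous u})
    (s_ode : forall t : R, 0 <= t ->
       has_deriv_within `[0, +oo[ s t (2 * r t * u t))
    (r_ode : forall t : R, 0 <= t -> has_deriv_within `[0, +oo[ r t 0)
    (sgn_u : forall t : R, 0 < t -> Num.sg (u t) = Num.sg (r t))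
    (r0_gt0 : 0 < r 0) (s0_gt0 : 0 < s 0)
    (h_gt0 : 0 < h) (k_ge0 : 0 <= k) (t : R) (t_gt0 : 0 < t) :
  exists U : {linear ell2 R -> L2 (gauss_measure h (r t) (s t))},
    [/\ hermite_operator U,
        forall V : {linear ell2 R -> L2 (gauss_measure h (r t) (s t))},
          hermite_operator V -> V =1 U,
        unitary U &
        forall g : L2 (gauss_measure h (r t) (s t)),
          (U @` finite_combinations R) g ->
          represents (U (osc_rep h k (lax_L (r t) (s t)) (adjoint U g)))
                     (fun x => x%:C * g x)].
Proof.
(* From here on [t] is fixed, and [r] and [s] are treated as numbers with [r > 0]. *)
have rt_gt0 : 0 < r t by rewrite (zero_derivative_const r_ode t_gt0).
move: (r t) (s t) rt_gt0.
move=> {r s u r_C1 s_C1 u_C0 s_ode r_ode sgn_u r0_gt0 s0_gt0 t t_gt0} r s r_gt0.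
have oe := @ell2_basis_orthonormal R; have te := @ell2_basis_total R.
have [P [PE oP tP]] := gauss_hermite_basis s h_gt0 r_gt0.
have [U [_ Ue iU]] := basis_isometry oe te oP tP.
have reprP n : represents (P n)
    (fun x => (hermite R n).[(x + h * s) / (r * Num.sqrt (2 * h))]%:C).
  by apply: represents_ae (PE n) _; apply: nearW => x; rewrite gauss_hermiteE.
have hU : hermite_operator U.
  split; last by move=> n; rewrite Ue.
  by exists 1 => f; rewrite !L2_normE iU mul1r.
have uU : unitary U := unitary_of_basis oe te oP tP Ue iU.
exists U; split => //.
  move=> V [bV Vh]; apply: (bounded_op_ext oe te bV hU.1) => n.
  exact: represents_inj (Vh n) (hU.2 n).
move=> _ [_ [N [c ->]] <-]; have [_ UK _] := uU.
rewrite UK osc_rep_finite.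
have UD f g : U (f + g) = U f + U g := raddfD U f g.
have UB f g : U (f - g) = U f - U g := raddfB U f g.
have UZ b f : U (b *: f) = b *: U f := linearZ_LR U b f.
have Usum (F : nat -> ell2 R) : U (\sum_(n < N) F n) = \sum_(n < N) U (F n).
  exact: raddf_sum.
(* The three-term recurrence at [y], multiplied by [r * sqrt h]: it produces [x + h s], and the
   diagonal term [- h s] removes the shift. At [n = 0] the lowering term has the factor [sqrt 0]. *)
have y_mul x n : r * Num.sqrt (h * n.+1%:R) * (gauss_hermite h r s n.+1).[x]
    - h * s * (gauss_hermite h r s n).[x]
    + r * Num.sqrt (h * n%:R) * (gauss_hermite h r s n.-1).[x] =
    x * (gauss_hermite h r s n).[x].
  rewrite !gauss_hermiteE; set y := _ / _.
  have := hermite_recurrence R n.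
  move: (hermite R n.+1) (hermite R n) (hermite R n.-1) => A B C.
  move=> /(congr1 (fun p : {poly R} => p.[y])).
  rewrite hornerZ hornerM hornerX hornerD !hornerZ => yB.
  have yE : r * Num.sqrt h * Num.sqrt 2 * y = x + h * s.
    rewrite /y sqrtrM//; field; rewrite !gt_eqF ?sqrtr_gt0//.
  rewrite !sqrtrM ?ltW//.
  transitivity (r * Num.sqrt h *
    (Num.sqrt n.+1%:R * A.[y] + Num.sqrt n%:R * C.[y]) - h * s * B.[y]).
    by ring.
  rewrite -yB; transitivity (r * Num.sqrt h * Num.sqrt 2 * y * B.[y] - h * s * B.[y]).
    by ring.
  by rewrite yE; ring.
have reprT n : represents (U (osc_rep_basis h k (lax_L r s) n))
    (fun x => x%:C * (gauss_hermite h r s n).[x]%:C).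
  rewrite osc_rep_basis_lax UD UB !UZ !Ue.
  apply: represents_ae (representsD (representsB (representsZ _ (PE _))
    (representsZ _ (PE _))) (representsZ _ (PE _))) _.
  by apply: nearW => x; rewrite -!rmorphM -rmorphB -rmorphD /= y_mul.
have reprU : represents (U (partial_sum (ell2_basis R) c N))
    (fun x => \sum_(n < N) c n * (gauss_hermite h r s n).[x]%:C).
  rewrite (Usum (fun n => c n *: ell2_basis R n)).
  rewrite (eq_bigr (fun n : 'I_N => c n *: P n)); last by move=> n _; rewrite UZ Ue.
  exact: (represents_sum N (fun n => representsZ (c n) (PE n))).
rewrite (Usum (fun n => c n *: osc_rep_basis h k (lax_L r s) n)).
rewrite (eq_bigr (fun n : 'I_N => c n *: U (osc_rep_basis h k (lax_L r s) n)));
  last by move=> n _; rewrite UZ.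
apply: represents_ae (represents_sum N (fun n => representsZ (c n) (reprT n))) _.
apply: filterS reprU => x ->; rewrite mulr_sumr; apply: eq_bigr => n _.
by rewrite mulrCA.
Qed.
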